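(* Let $d>0$ be an integer, let $\mathcal{C}$ be a left triangulated category and let $\mathcal{X}$ be a $d\mathbb{Z}$-cluster tilting subcategory of $\mathcal{C}$. Then $d\mathbb{Z}\mathcal{X}$ is a $d\mathbb{Z}$-cluster tilting subcategory of the triangulated category $\mathbb{Z}\mathcal{C}$.
   Context: Left triangulated category: an additive category $\mathcal{C}$ with an additive endofunctor $\Omega$ and a class of sequences $\Omega C\to A\to B\to C$, called triangles, such that (morphisms of such sequences being triples $(f,g,h)$ giving commutative diagrams with $\Omega h,f,g,h$): (T0) sequences isomorphic to triangles are triangles; (T1) $0\to C\xrightarrow{1}C\to 0$ is a triangle for all $C$; (T2) every $w\colon B\to C$ is the last map of a triangle $\Omega C\to A\to B\xrightarrow{w}C$; (T3) if $\Omega C\xrightarrow{u}A\xrightarrow{v}B\xrightarrow{w}C$ is a triangle, so is $\Omega B\xrightarrow{-\Omega(w)}\Omega C\xrightarrow{u}A\xrightarrow{v}B$; (T4) given triangles $\Omega C\xrightarrow{u}A\xrightarrow{v}B\xrightarrow{w}C$, $\Omega C'\xrightarrow{u'}A'\xrightarrow{v'}B'\xrightarrow{w'}C'$ and $g\colon B\to B'$, $h\colon C\to C'$ with $hw=w'g$, there is $f\colon A\to A'$ with $fu=u'\Omega(h)$, $gv=v'f$; (T5) given triangles $\Omega C\xrightarrow{u}A\xrightarrow{v}B\xrightarrow{w}C$ and $\Omega D\xrightarrow{f}E\xrightarrow{g}C\xrightarrow{h}D$, there are triangles $\Omega D\xrightarrow{i}F\xrightarrow{j}B\xrightarrow{hw}D$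 and $\Omega E\xrightarrow{u\circ\Omega(g)}A\xrightarrow{\alpha}F\xrightarrow{\beta}E$ with $\alpha u=i\Omega(h)$, $j\alpha=v$, $\beta i=f$, $g\beta=wj$. $(d+2)$-angles: a sequence $\Omega^d(C_1)\xrightarrow{\alpha_{d+2}}C_{d+2}\xrightarrow{\alpha_{d+1}}C_{d+1}\to\cdots\to C_2\xrightarrow{\alpha_1}C_1$ in $\mathcal{C}$ is a $(d+2)$-angle if there are objects $K_1=C_1,K_2,\dots,K_d,K_{d+1}=C_{d+2}$ and triangles $\Omega K_i\xrightarrow{u_i}K_{i+1}\xrightarrow{v_i}C_{i+1}\xrightarrow{w_i}K_i$ for $1\le i\le d$ such that $\alpha_1=w_1$, $\alpha_{d+1}=v_d$, $\alpha_i=v_{i-1}w_i$ for $2\le i\le d$, and $\alpha_{d+2}$ is the composite $\Omega^dK_1\xrightarrow{\Omega^{d-1}(u_1)}\Omega^{d-1}K_2\to\cdots\to\Omega K_d\xrightarrow{u_d}K_{d+1}$. Cluster tilting in a left triangulated category: a full additive subcategory $\mathcal{X}\subseteq\mathcal{C}$ is $d$-cluster tilting if (1) $\mathcal{X}$ is closed under direct summands in $\mathcal{C}$; (2) for every $C\in\mathcal{C}$ there are $(d+2)$-angles $0\to C\to X^1\to\cdots\to X^d\to 0$ and $0\to X_d\to\cdots\to X_1\to C\to 0$ with all $X_i,X^i\in\mathcal{X}$; (3) for $C\in\mathcal{C}$, $X\in\mathcal{X}$ and $1\le i\le d-1$ the map $\operatorname{Hom}_{\mathcal{C}}(\Omega^{i-1}(X),C)\to\operatorname{Hom}_{\mathcal{C}}(\Omega^i(X),\Omega(C))$,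 $f\mapsto\Omega(f)$, is an isomorphism; (4) $\operatorname{Hom}_{\mathcal{C}}(\Omega^i(X'),X)=0$ for $X,X'\in\mathcal{X}$ and $1\le i\le d-1$. It is $d\mathbb{Z}$-cluster tilting if moreover $\Omega^d(\mathcal{X})\subseteq\mathcal{X}$. Stabilization: $\mathbb{Z}\mathcal{C}$ has objects the pairs $(C,n)$, $C\in\mathcal{C}$, $n\in\mathbb{Z}$, and $\operatorname{Hom}_{\mathbb{Z}\mathcal{C}}((C,m),(C',n))=\operatorname{colim}_k\operatorname{Hom}_{\mathcal{C}}(\Omega^{m+k}(C),\Omega^{n+k}(C'))$ over $k$ with $m+k,n+k\ge 0$, transition maps given by $\Omega$. It is triangulated (Keller–Vossieck) with suspension $\Sigma(C,n)=(C,n-1)$, inverse to $\Omega(C,n)=(C,n+1)$; its triangles are the sequences $\Omega(C_1,n_1)\to(C_3,n_3)\to(C_2,n_2)\to(C_1,n_1)$ induced by some $\Omega^{k+n_1+1}(C_1)\xrightarrow{u}\Omega^{k+n_3}(C_3)\xrightarrow{v}\Omega^{k+n_2}(C_2)\xrightarrow{w}\Omega^{k+n_1}(C_1)$ such that the sequence with maps $(-1)^ku,(-1)^kv,(-1)^kw$ is a triangle in $\mathcal{C}$. $d\mathbb{Z}\mathcal{X}$ is the full subcategory of $\mathbb{Z}\mathcal{C}$ of all objects isomorphic to some $(X,dk)$ with $X\in\mathcal{X}$, $k\in\mathbb{Z}$. Cluster tilting in a triangulated category $\mathcal{T}$ with suspension $\Sigma$: a full subcategory $\mathcal{N}$ is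 $d$-cluster tilting if it is functorially finite (every object has a left and a right $\mathcal{N}$-approximation) and $\mathcal{N}=\{T\mid\operatorname{Hom}(T,\Sigma^i\mathcal{N})=0,\ 1\le i\le d-1\}=\{T\mid\operatorname{Hom}(\mathcal{N},\Sigma^iT)=0,\ 1\le i\le d-1\}$; it is $d\mathbb{Z}$-cluster tilting if moreover $\operatorname{Hom}(\mathcal{N},\Sigma^i\mathcal{N})=0$ for $i\notin d\mathbb{Z}$. *)

(* Defs.v *)
From HB Require Import structures.
From mathcomp Require Import all_boot all_order all_algebra.
From mathcomp Require Import boolp.
From mathcomp Require Import zify.

Set Implicit Arguments.
Unset Strict Implicit.
Unset Printing Implicit Defensive.

Import GRing.Theory.
Local Open Scope quotient_scope.
Local Open Scope ring_scope.

Reserved Notation "g \oc f" (at level 50, left associativity).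

(* Stated on raw data so that they can be used as fields of [addCat]; see
   [is_biproduct] and [is_zero] below. *)
Definition biproduct_eqns (Ob : Type) (hom : Ob -> Ob -> zmodType)
    (idm : forall A, hom A A)
    (comp : forall A B C, hom B C -> hom A B -> hom A C) (A B P : Ob) : Prop :=
  exists (i1 : hom A P) (i2 : hom B P) (p1 : hom P A) (p2 : hom P B),
    [/\ comp _ _ _ p1 i1 = idm A, comp _ _ _ p2 i2 = idm B,
        comp _ _ _ p1 i2 = 0, comp _ _ _ p2 i1 = 0
      & comp _ _ _ i1 p1 + comp _ _ _ i2 p2 = idm P].

Definition zero_eqns (Ob : Type) (hom : Ob -> Ob -> zmodType) (Z : Ob) : Prop :=
  forall A, (forall f : hom A Z, f = 0) /\ (forall f : hom Z A, f = 0).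

Record addCat := AddCat {
  obj :> Type;
  hom : obj -> obj -> zmodType;
  idm : forall A, hom A A;
  comp : forall A B C, hom B C -> hom A B -> hom A C;
  compA : forall A B C D (h : hom C D) (g : hom B C) (f : hom A B),
    comp h (comp g f) = comp (comp h g) f;
  comp1m : forall A B (f : hom A B), comp (idm B) f = f;
  compm1 : forall A B (f : hom A B), comp f (idm A) = f;
  compDl : forall A B C (g g' : hom B C) (f : hom A B),
    comp (g + g') f = comp g f + comp g' f;
  compDr : forall A B C (g : hom B C) (f f' : hom A B),
    comp g (f + f') = comp g f + comp g f';
  zero_ex : exists Z, zero_eqns hom Z;
  biproduct_ex : forall A B, exists P, biproduct_eqns idm comp A B P
}.

Arguments hom {a} : rename.
Arguments idm {a} A : rename.

Notation "g \oc f" := (comp g f) : ring_scope.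

Definition is_zero (C : addCat) (Z : C) : Prop := zero_eqns hom Z.

Definition is_biproduct (C : addCat) (A B P : C) : Prop :=
  biproduct_eqns idm (@comp C) A B P.

Definition is_iso (C : addCat) (A B : C) (f : hom A B) : Prop :=
  exists g : hom B A, g \oc f = idm A /\ f \oc g = idm B.

Definition isomorphic (C : addCat) (A B : C) : Prop :=
  exists f : hom A B, is_iso f.

(* The identity of A, seen as a morphism from A to an equal object. *)
Definition eqm (C : addCat) (A B : C) (e : A = B) : hom A B :=
  eq_rect A (hom A) (idm A) B e.

Record endofunctor (C : addCat) := Endofunctor {
  fob :> C -> C;
  fmap : forall A B, hom A B -> hom (fob A) (fob B);
  fmap1 : forall A, fmap (idm A) = idm (fob A);
  fmapM : forall A B D (g : hom B D) (f : hom A B),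
    fmap (g \oc f) = fmap g \oc fmap f;
  fmapD : forall A B (f g : hom A B), fmap (f + g) = fmap f + fmap g
}.

Record leftTri := LeftTri {
  ltcat :> addCat;
  Om : endofunctor ltcat;
  (* tri u v w: Om C -u-> A -v-> B -w-> C is a triangle *)
  tri : forall C A B : ltcat,
    hom (Om C) A -> hom A B -> hom B C -> Prop;
  tri_iso : forall (C A B C' A' B' : ltcat)
      (u : hom (Om C) A) (v : hom A B) (w : hom B C)
      (u' : hom (Om C') A') (v' : hom A' B') (w' : hom B' C')
      (f : hom A A') (g : hom B B') (h : hom C C'),
    is_iso f -> is_iso g -> is_iso h ->
    f \oc u = u' \oc fmap Om h -> g \oc v = v' \oc f -> h \oc w = w' \oc g ->
    tri u v w -> tri u' v' w';
  tri_id : forall C Z : ltcat, is_zero Z ->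
    tri (0 : hom (Om Z) C) (idm C) (0 : hom C Z);
  tri_ex : forall (B C : ltcat) (w : hom B C),
    exists (A : ltcat) (u : hom (Om C) A) (v : hom A B), tri u v w;
  tri_rot : forall (C A B : ltcat)
      (u : hom (Om C) A) (v : hom A B) (w : hom B C),
    tri u v w -> tri (- fmap Om w) u v;
  tri_mor : forall (C A B C' A' B' : ltcat)
      (u : hom (Om C) A) (v : hom A B) (w : hom B C)
      (u' : hom (Om C') A') (v' : hom A' B') (w' : hom B' C')
      (g : hom B B') (h : hom C C'),
    tri u v w -> tri u' v' w' -> h \oc w = w' \oc g ->
    exists f : hom A A', f \oc u = u' \oc fmap Om h /\ g \oc v = v' \oc f;
  tri_oct : forall (A B C D E : ltcat)
      (u : hom (Om C) A) (v : hom A B) (w : hom B C)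
      (f : hom (Om D) E) (g : hom E C) (h : hom C D),
    tri u v w -> tri f g h ->
    exists (F : ltcat) (i : hom (Om D) F) (j : hom F B)
           (al : hom A F) (be : hom F E),
      [/\ tri i j (h \oc w), tri (u \oc fmap Om g) al be
        & [/\ al \oc u = i \oc fmap Om h, j \oc al = v,
              be \oc i = f & g \oc be = w \oc j]]
}.

(* Presented through the inverse Om of the suspension Sg, with triangles written
   Om C -> A -> B -> C: a triangulated category is a left triangulated category
   whose loop functor is an equivalence. *)
Record triCat := TriCat {
  tlt :> leftTri;
  Sg : endofunctor tlt;
  OmSg : forall A : tlt, hom (Om tlt (Sg A)) A;
  OmSg_iso : forall A, is_iso (OmSg A);
  OmSg_nat : forall (A B : tlt) (f : hom A B),
    f \oc OmSg A = OmSg B \oc fmap (Om tlt) (fmap Sg f);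
  SgOm : forall A : tlt, hom (Sg (Om tlt A)) A;
  SgOm_iso : forall A, is_iso (SgOm A);
  SgOm_nat : forall (A B : tlt) (f : hom A B),
    f \oc SgOm A = SgOm B \oc fmap Sg (fmap (Om tlt) f)
}.

Definition shiftz (T : triCat) (i : int) (A : T) : T :=
  match i with
  | Posz n => iter n (Sg T) A
  | Negz n => iter n.+1 (Om T) A
  end.

Section Stabilization.
Variables (C : addCat) (Omega : endofunctor C).

Lemma comp0m (A B D : C) (f : hom A B) : (0 : hom B D) \oc f = 0.
Proof. by apply: (addrI (0 \oc f)); rewrite -compDl !addr0. Qed.
Lemma compm0 (A B D : C) (g : hom B D) : g \oc (0 : hom A B) = 0.
Proof. by apply: (addrI (g \oc 0)); rewrite -compDr !addr0. Qed.
Lemma compNm (A B D : C) (g : hom B D) (f : hom A B) : - g \oc f = - (g \oc f).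
Proof. by apply: (addrI (g \oc f)); rewrite -compDl !subrr comp0m. Qed.
Lemma compmN (A B D : C) (g : hom B D) (f : hom A B) : g \oc - f = - (g \oc f).
Proof. by apply: (addrI (g \oc f)); rewrite -compDr !subrr compm0. Qed.
Lemma fmap0 (A B : C) : fmap Omega (0 : hom A B) = 0.
Proof. by apply: (addrI (fmap Omega 0)); rewrite -fmapD !addr0. Qed.
Lemma fmapN (A B : C) (f : hom A B) : fmap Omega (- f) = - fmap Omega f.
Proof. by apply: (addrI (fmap Omega f)); rewrite -fmapD !subrr fmap0. Qed.

Definition zob : Type := (C * int)%type.

(* Om^p X.1 is the k-th stage Om^(n+k) C of the object X = (C, n); existence of
   the natural number p is the condition n + k >= 0. *)
Definition stage (X : zob) (k : int) (p : nat) : Prop := p%:Z = X.2 + k.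

Lemma stage_irr X k p (h h' : stage X k p) : h = h'.
Proof. exact: eq_irrelevance. Qed.

Lemma stageS X k p : stage X k p -> stage X (k + 1) p.+1.
Proof. rewrite /stage; lia. Qed.

(* An element of the disjoint union over k of Hom (Om^(m+k) C) (Om^(n+k) C') *)
Record germ (X Y : zob) := Germ {
  gk : int;
  gp : nat;
  gq : nat;
  gpP : stage X gk gp;
  gqP : stage Y gk gq;
  gmor : hom (iter gp Omega X.1) (iter gq Omega Y.1)
}.

HB.instance Definition _ X Y := gen_eqMixin (germ X Y).
HB.instance Definition _ X Y := gen_choiceMixin (germ X Y).

Definition gstep X Y (a : germ X Y) : germ X Y :=
  @Germ X Y (gk a + 1) (gp a).+1 (gq a).+1 (stageS (gpP a)) (stageS (gqP a))
    (fmap Omega (gmor a)).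

Definition germ_rel X Y (a b : germ X Y) : bool :=
  `[< exists r s, iter r (@gstep X Y) a = iter s (@gstep X Y) b >].

Lemma germ_rel_refl X Y : reflexive (@germ_rel X Y).
Proof. by move=> a; apply/asboolP; exists 0, 0. Qed.

Lemma germ_rel_sym X Y : symmetric (@germ_rel X Y).
Proof.
by move=> a b; apply/asboolP/asboolP => -[r [s e]]; exists s, r.
Qed.

Lemma germ_rel_trans X Y : transitive (@germ_rel X Y).
Proof.
move=> b a c /asboolP[r [s e]] /asboolP[r' [s' e']]; apply/asboolP.
exists (r' + r)%N, (s + s')%N.
by rewrite !iterD e -e' -!iterD addnC.
Qed.

Canonical germ_equiv X Y :=
  EquivRel (@germ_rel X Y) (@germ_rel_refl X Y) (@germ_rel_sym X Y)
    (@germ_rel_trans X Y).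

Definition zhom (X Y : zob) := {eq_quot germ_equiv X Y}.
HB.instance Definition _ X Y := Choice.on (zhom X Y).
HB.instance Definition _ X Y := EqQuotient.on (zhom X Y).

Definition cls (X Y : zob) k p q (hp : stage X k p) (hq : stage Y k q)
    (f : hom (iter p Omega X.1) (iter q Omega Y.1)) : zhom X Y :=
  \pi_(zhom X Y) (Germ hp hq f).

Lemma cls_step X Y k p q (hp : stage X k p) (hq : stage Y k q) f
    (hp' : stage X (k + 1) p.+1) (hq' : stage Y (k + 1) q.+1) :
  cls hp hq f = cls hp' hq' (fmap Omega f).
Proof.
apply/eqmodP/asboolP; exists 1%N, 0%N => /=.
by rewrite /gstep /= (stage_irr hp' (stageS hp)) (stage_irr hq' (stageS hq)).
Qed.

Fixpoint up (A B : C) p q (f : hom (iter p Omega A) (iter q Omega B)) r :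
    hom (iter (r + p) Omega A) (iter (r + q) Omega B) :=
  match r with
  | 0 => f
  | r'.+1 => fmap Omega (up f r')
  end.

Lemma upM (A B D : C) p q s (g : hom (iter q Omega B) (iter s Omega D))
    (f : hom (iter p Omega A) (iter q Omega B)) r :
  up (g \oc f) r = up g r \oc up f r.
Proof. by elim: r => //= r ->; rewrite fmapM. Qed.

Lemma upD (A B : C) p q (f g : hom (iter p Omega A) (iter q Omega B)) r :
  up (f + g) r = up f r + up g r.
Proof. by elim: r => //= r ->; rewrite fmapD. Qed.

Lemma upN (A B : C) p q (f : hom (iter p Omega A) (iter q Omega B)) r :
  up (- f) r = - up f r.
Proof. by elim: r => //= r ->; rewrite fmapN. Qed.

Lemma up0 (A B : C) p q r :
  up (0 : hom (iter p Omega A) (iter q Omega B)) r = 0.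
Proof. by elim: r => //= r ->; rewrite fmap0. Qed.

Lemma up1 (A : C) p r : up (idm (iter p Omega A)) r = idm (iter (r + p) Omega A).
Proof. by elim: r => //= r ->; rewrite fmap1. Qed.

Lemma iter_gstep X Y k p q (hp : stage X k p) (hq : stage Y k q) f r
    (hp' : stage X (k + r%:Z) (r + p)) (hq' : stage Y (k + r%:Z) (r + q)) :
  iter r (@gstep X Y) (Germ hp hq f) = Germ hp' hq' (up f r).
Proof.
elim: r hp' hq' => [|r IH] hp' hq' /=.
  have e : k + 0%:Z = k by lia.
  case: (k + 0%:Z) / (esym e) hp' hq' => hp' hq'.
  by rewrite (stage_irr hp' hp) (stage_irr hq' hq).
have hr : stage X (k + r%:Z) (r + p) by have := hp; rewrite /stage; lia.
have hr' : stage Y (k + r%:Z) (r + q) by have := hq; rewrite /stage; lia.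
rewrite (IH hr hr') /gstep /=.
have e : k + r.+1%:Z = k + r%:Z + 1 by lia.
move: (stageS _) (stageS _) hp' hq'; rewrite /= e => a b c d.
by rewrite (stage_irr b c) (stage_irr a d).
Qed.

Lemma cls_up X Y k p q (hp : stage X k p) (hq : stage Y k q) f r
    (hp' : stage X (k + r%:Z) (r + p)) (hq' : stage Y (k + r%:Z) (r + q)) :
  cls hp hq f = cls hp' hq' (up f r).
Proof.
apply/eqmodP/asboolP; exists r, 0%N => /=; exact: iter_gstep.
Qed.

Lemma Germ_inj X Y k p q (hp hp' : stage X k p) (hq hq' : stage Y k q) f f' :
  Germ hp hq f = Germ hp' hq' f' -> f = f'.
Proof.
pose F (a : germ X Y) (e : gp a = p) (e' : gq a = q) :=
  ecast q' (hom (iter p Omega X.1) (iter q' Omega Y.1)) e'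
  (ecast p' (hom (iter p' Omega X.1) (iter (gq a) Omega Y.1)) e (gmor a)).
move=> E.
have : forall a (ea : a = Germ hp hq f) (e : gp a = p) (e' : gq a = q),
    F a e e' = f.
  by move=> _ -> /= e e'; rewrite /F (eq_axiomK e) (eq_axiomK e').
by move=> /(_ _ (esym E) erefl erefl) <-.
Qed.

Lemma cls_eq X Y k p q (hp : stage X k p) (hq : stage Y k q) f f' :
  cls hp hq f = cls hp hq f' <-> exists r, up f r = up f' r.
Proof.
have hr r : stage X (k + r%:Z) (r + p) by move: hp; rewrite /stage; lia.
have hr' r : stage Y (k + r%:Z) (r + q) by move: hq; rewrite /stage; lia.
split=> [/eqmodP/asboolP[r [s]]|[r e]]; last first.
  by rewrite (cls_up hp hq f (hr r) (hr' r)) e -cls_up.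
rewrite (iter_gstep hp hq f (hr r) (hr' r)) (iter_gstep hp hq f' (hr s) (hr' s)) => E.
have rs : r = s by have := congr1 (@gk X Y) E => /=; lia.
by case: s / rs E => /Germ_inj E; exists r.
Qed.

(* P k holds for all large k *)
Definition ev (P : int -> Prop) : Prop :=
  exists N : nat, forall k : int, N%:Z <= k -> P k.

Lemma ev_and P Q : ev P -> ev Q -> ev (fun k => P k /\ Q k).
Proof.
move=> [N hN] [M hM]; exists (N + M)%N => k hk; split; [apply: hN|apply: hM]; lia.
Qed.

Lemma ev_ge k0 : ev (fun k => k0 <= k).
Proof. exists `|k0|%N => k; lia. Qed.

Lemma ev_ex P : ev P -> exists k, P k.
Proof. by move=> [N hN]; exists N%:Z; apply: hN. Qed.

Lemma ev_stage (X : zob) : ev (fun k => exists p, stage X k p).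
Proof.
exists `|X.2|%N => k hk; exists (absz (X.2 + k)); rewrite /stage; lia.
Qed.

Lemma le_stage (k k' : int) : k <= k' -> exists r : nat, k' = k + r%:Z.
Proof. by move=> h; exists (absz (k' - k)); lia. Qed.

Lemma stage_eq X k p (r : nat) p' : stage X k p -> stage X (k + r%:Z) p' ->
  p' = (r + p)%N.
Proof. rewrite /stage; lia. Qed.

Lemma stage_fun X k p p' : stage X k p -> stage X k p' -> p' = p.
Proof. rewrite /stage; lia. Qed.

Lemma cls_ev X Y (a : zhom X Y) :
  ev (fun k => forall p q (hp : stage X k p) (hq : stage Y k q),
    exists f, a = cls hp hq f).
Proof.
elim/quotW: a => -[k p q hp hq f].
have [N hN] := ev_ge k; exists N => k' /hN /le_stage[r ->] p' q' hp' hq'.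
have ep := stage_eq hp hp'; have eq' := stage_eq hq hq'; subst p' q'.
by exists (up f r); apply: cls_up.
Qed.

Lemma cls_ev_eq X Y k p q (hp : stage X k p) (hq : stage Y k q) f f' :
  cls hp hq f = cls hp hq f' -> ev (fun k' => exists r : nat, k' = k + r%:Z
   /\ up f r = up f' r).
Proof.
move=> /cls_eq[r e]; have [N hN] := ev_ge (k + r%:Z); exists N => k' /hN.
move=> /le_stage[s ->]; exists (s + r)%N; split; first by lia.
elim: s => //= s IH; first by rewrite IH.
Qed.

(* The operations are computed on representatives at a common stage; they are
   first chosen arbitrarily, and zcompE, zaddE, zoppE, zzeroE, zidE show that the
   result does not depend on the choice. *)

Lemma zcomp_ex X Y Z (b : zhom Y Z) (a : zhom X Y) :
  exists c : zhom X Z, exists k p q r (hp : stage X k p) (hq : stage Y k q)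
    (hr : stage Z k r) g f,
  [/\ b = cls hq hr g, a = cls hp hq f & c = cls hp hr (g \oc f)].
Proof.
have [k [hb [ha [[p hp] [[q hq] [r hr]]]]]] := ev_ex (ev_and (cls_ev b)
  (ev_and (cls_ev a) (ev_and (ev_stage X) (ev_and (ev_stage Y) (ev_stage Z))))).
have [g bE] := hb _ _ hq hr; have [f aE] := ha _ _ hp hq.
by exists (cls hp hr (g \oc f)), k, p, q, r, hp, hq, hr, g, f.
Qed.

Lemma zadd_ex X Y (a b : zhom X Y) :
  exists c : zhom X Y, exists k p q (hp : stage X k p) (hq : stage Y k q) f g,
  [/\ a = cls hp hq f, b = cls hp hq g & c = cls hp hq (f + g)].
Proof.
have [k [hb [ha [[p hp] [q hq]]]]] := ev_ex (ev_and (cls_ev b)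
  (ev_and (cls_ev a) (ev_and (ev_stage X) (ev_stage Y)))).
have [g bE] := hb _ _ hp hq; have [f aE] := ha _ _ hp hq.
by exists (cls hp hq (f + g)), k, p, q, hp, hq, f, g.
Qed.

Lemma zopp_ex X Y (a : zhom X Y) :
  exists c : zhom X Y, exists k p q (hp : stage X k p) (hq : stage Y k q) f,
  a = cls hp hq f /\ c = cls hp hq (- f).
Proof.
have [k [ha [[p hp] [q hq]]]] := ev_ex
  (ev_and (cls_ev a) (ev_and (ev_stage X) (ev_stage Y))).
have [f aE] := ha _ _ hp hq.
by exists (cls hp hq (- f)), k, p, q, hp, hq, f.
Qed.

Lemma zzero_ex X Y :
  exists c : zhom X Y, exists k p q (hp : stage X k p) (hq : stage Y k q),
  c = cls hp hq 0.
Proof.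
have [k [[p hp] [q hq]]] := ev_ex (ev_and (ev_stage X) (ev_stage Y)).
by exists (cls hp hq 0), k, p, q, hp, hq.
Qed.

Lemma zid_ex X :
  exists c : zhom X X, exists k p (hp : stage X k p), c = cls hp hp (idm _).
Proof.
have [k [p hp]] := ev_ex (ev_stage X).
by exists (cls hp hp (idm _)), k, p, hp.
Qed.

Definition zcomp X Y Z (b : zhom Y Z) (a : zhom X Y) : zhom X Z :=
  projT1 (cid (zcomp_ex b a)).
Definition zadd X Y (a b : zhom X Y) : zhom X Y := projT1 (cid (zadd_ex a b)).
Definition zopp X Y (a : zhom X Y) : zhom X Y := projT1 (cid (zopp_ex a)).
Definition zzero X Y : zhom X Y := projT1 (cid (zzero_ex X Y)).
Definition zid X : zhom X X := projT1 (cid (zid_ex X)).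

Lemma zcomp_same X Y Z k p q r (hp : stage X k p) (hq : stage Y k q)
    (hr : stage Z k r) g g' f f' :
  cls hq hr g = cls hq hr g' -> cls hp hq f = cls hp hq f' ->
  cls hp hr (g \oc f) = cls hp hr (g' \oc f').
Proof.
move=> /cls_ev_eq eg /cls_ev_eq ef.
have [k' [[s [-> es]] [s' [e es']]]] := ev_ex (ev_and eg ef).
have ss : s = s' by lia.
by subst s'; apply/cls_eq; exists s; rewrite !upM es es'.
Qed.

Lemma zcomp_up X Y Z k p q r (hp : stage X k p) (hq : stage Y k q)
    (hr : stage Z k r) g f k' p' q' r' (hp' : stage X k' p')
    (hq' : stage Y k' q') (hr' : stage Z k' r') : k <= k' ->
  exists g' f', [/\ cls hq hr g = cls hq' hr' g', cls hp hq f = cls hp' hq' f'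
   & cls hp hr (g \oc f) = cls hp' hr' (g' \oc f')].
Proof.
move=> /le_stage[s e]; subst k'.
have ep := stage_eq hp hp'; have eq' := stage_eq hq hq'.
have er := stage_eq hr hr'; subst p' q' r'.
by exists (up g s), (up f s); rewrite -upM -!cls_up.
Qed.

Lemma zcompE X Y Z k p q r (hp : stage X k p) (hq : stage Y k q)
    (hr : stage Z k r) g f :
  zcomp (cls hq hr g) (cls hp hq f) = cls hp hr (g \oc f).
Proof.
rewrite /zcomp; case: cid => _ /= [k' [p' [q' [r' [hp' [hq' [hr' [g' [f'
  [eg ef ->]]]]]]]]]].
have [l [hl [hl' [[a ha] [[b hb] [c hc]]]]]] := ev_ex (ev_and (ev_ge k)
  (ev_and (ev_ge k') (ev_and (ev_stage X) (ev_and (ev_stage Y) (ev_stage Z))))).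
have [g1 [f1 [e1 e2 ->]]] := zcomp_up hp hq hr g f ha hb hc hl.
have [g2 [f2 [e1' e2' ->]]] := zcomp_up hp' hq' hr' g' f' ha hb hc hl'.
by apply: zcomp_same; rewrite -?e1 -?e1' -?e2 -?e2'.
Qed.

Lemma cls_shift2 X Y k p q (hp : stage X k p) (hq : stage Y k q) f g
   k' p' q' (hp' : stage X k' p') (hq' : stage Y k' q') : k <= k' ->
  exists f' g', [/\ cls hp hq f = cls hp' hq' f', cls hp hq g = cls hp' hq' g',
    cls hp hq (f + g) = cls hp' hq' (f' + g'),
    cls hp hq (- f) = cls hp' hq' (- f')
  & cls hp hq 0 = cls hp' hq' 0].
Proof.
move=> /le_stage[s e]; subst k'.
have ep := stage_eq hp hp'; have eq' := stage_eq hq hq'; subst p' q'.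
exists (up f s), (up g s).
by rewrite -upD -upN -(up0 _ _ _ _ s) -!cls_up.
Qed.

Lemma zaddE X Y k p q (hp : stage X k p) (hq : stage Y k q) f g :
  zadd (cls hp hq f) (cls hp hq g) = cls hp hq (f + g).
Proof.
rewrite /zadd; case: cid => _ /= [k' [p' [q' [hp' [hq' [f' [g'
  [ef eg ->]]]]]]]].
have [l [hl [hl' [[a ha] [b hb]]]]] := ev_ex (ev_and (ev_ge k)
  (ev_and (ev_ge k') (ev_and (ev_stage X) (ev_stage Y)))).
have [f1 [g1 [e1 e2 -> _ _]]] := cls_shift2 hp hq f g ha hb hl.
have [f2 [g2 [e1' e2' -> _ _]]] := cls_shift2 hp' hq' f' g' ha hb hl'.
have /cls_ev_eq ef2 : cls ha hb f1 = cls ha hb f2 by rewrite -e1 -e1'.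
have /cls_ev_eq eg2 : cls ha hb g1 = cls ha hb g2 by rewrite -e2 -e2'.
have [m [[s [-> es]] [s' [e es']]]] := ev_ex (ev_and ef2 eg2).
have ss : s = s' by lia.
by subst s'; apply/cls_eq; exists s; rewrite !upD es es'.
Qed.

Lemma zoppE X Y k p q (hp : stage X k p) (hq : stage Y k q) f :
  zopp (cls hp hq f) = cls hp hq (- f).
Proof.
rewrite /zopp; case: cid => _ /= [k' [p' [q' [hp' [hq' [f' [ef ->]]]]]]].
have [l [hl [hl' [[a ha] [b hb]]]]] := ev_ex (ev_and (ev_ge k)
  (ev_and (ev_ge k') (ev_and (ev_stage X) (ev_stage Y)))).
have [f1 [g1 [e1 _ _ -> _]]] := cls_shift2 hp hq f 0 ha hb hl.
have [f2 [g2 [e1' _ _ -> _]]] := cls_shift2 hp' hq' f' 0 ha hb hl'.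
have /cls_eq[s es] : cls ha hb f1 = cls ha hb f2 by rewrite -e1 -e1'.
by apply/cls_eq; exists s; rewrite !upN es.
Qed.

Lemma zzeroE X Y k p q (hp : stage X k p) (hq : stage Y k q) :
  zzero X Y = cls hp hq 0.
Proof.
rewrite /zzero; case: cid => _ /= [k' [p' [q' [hp' [hq' ->]]]]].
have [l [hl [hl' [[a ha] [b hb]]]]] := ev_ex (ev_and (ev_ge k)
  (ev_and (ev_ge k') (ev_and (ev_stage X) (ev_stage Y)))).
have [f1 [g1 [_ _ _ _ ->]]] := cls_shift2 hp hq 0 0 ha hb hl.
by have [f2 [g2 [_ _ _ _ ->]]] := cls_shift2 hp' hq' 0 0 ha hb hl'.
Qed.

Lemma cls_id X k p (hp : stage X k p) k' p' (hp' : stage X k' p') : k <= k' ->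
  cls hp hp (idm _) = cls hp' hp' (idm _).
Proof.
move=> /le_stage[s e]; subst k'.
by have ep := stage_eq hp hp'; subst p'; rewrite -up1 -cls_up.
Qed.

Lemma zidE X k p (hp : stage X k p) : zid X = cls hp hp (idm _).
Proof.
rewrite /zid; case: cid => _ /= [k' [p' [hp' ->]]].
have [l [hl [hl' [a ha]]]] :=
  ev_ex (ev_and (ev_ge k) (ev_and (ev_ge k') (ev_stage X))).
by rewrite (cls_id hp ha) ?(cls_id hp' ha).
Qed.

Lemma zaddA X Y : associative (@zadd X Y).
Proof.
move=> a b c.
have [k [ha [hb [hc [[p hp] [q hq]]]]]] := ev_ex (ev_and (cls_ev a)
  (ev_and (cls_ev b) (ev_and (cls_ev c) (ev_and (ev_stage X) (ev_stage Y))))).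
have [f ->] := ha _ _ hp hq; have [g ->] := hb _ _ hp hq.
by have [h ->] := hc _ _ hp hq; rewrite !zaddE addrA.
Qed.

Lemma zaddC X Y : commutative (@zadd X Y).
Proof.
move=> a b; have [k [ha [hb [[p hp] [q hq]]]]] := ev_ex (ev_and (cls_ev a)
  (ev_and (cls_ev b) (ev_and (ev_stage X) (ev_stage Y)))).
have [f ->] := ha _ _ hp hq; have [g ->] := hb _ _ hp hq.
by rewrite !zaddE addrC.
Qed.

Lemma zadd0 X Y : left_id (zzero X Y) (@zadd X Y).
Proof.
move=> a; have [k [ha [[p hp] [q hq]]]] := ev_ex (ev_and (cls_ev a)
  (ev_and (ev_stage X) (ev_stage Y))).
by have [f ->] := ha _ _ hp hq; rewrite (zzeroE hp hq) zaddE add0r.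
Qed.

Lemma zaddN X Y : left_inverse (zzero X Y) (@zopp X Y) (@zadd X Y).
Proof.
move=> a; have [k [ha [[p hp] [q hq]]]] := ev_ex (ev_and (cls_ev a)
  (ev_and (ev_stage X) (ev_stage Y))).
by have [f ->] := ha _ _ hp hq; rewrite (zzeroE hp hq) zoppE zaddE addNr.
Qed.

HB.instance Definition _ X Y := GRing.isZmodule.Build (zhom X Y)
  (@zaddA X Y) (@zaddC X Y) (@zadd0 X Y) (@zaddN X Y).

Lemma clsD X Y k p q (hp : stage X k p) (hq : stage Y k q) f g :
  cls hp hq f + cls hp hq g = cls hp hq (f + g).
Proof. exact: zaddE. Qed.

Lemma clsN X Y k p q (hp : stage X k p) (hq : stage Y k q) f :
  - cls hp hq f = cls hp hq (- f).
Proof. exact: zoppE. Qed.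

Lemma cls0 X Y k p q (hp : stage X k p) (hq : stage Y k q) :
  0 = cls hp hq 0 :> zhom X Y.
Proof. exact: zzeroE. Qed.

Lemma zcompA X Y Z T (c : zhom Z T) (b : zhom Y Z) (a : zhom X Y) :
  zcomp c (zcomp b a) = zcomp (zcomp c b) a.
Proof.
have [k [ha [hb [hc [[p hp] [[q hq] [[r hr] [s hs]]]]]]]] := ev_ex
  (ev_and (cls_ev a) (ev_and (cls_ev b) (ev_and (cls_ev c) (ev_and (ev_stage X)
  (ev_and (ev_stage Y) (ev_and (ev_stage Z) (ev_stage T))))))).
have [f ->] := ha _ _ hp hq; have [g ->] := hb _ _ hq hr.
by have [h ->] := hc _ _ hr hs; rewrite !zcompE compA.
Qed.

Lemma zcomp1m X Y (a : zhom X Y) : zcomp (zid Y) a = a.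
Proof.
have [k [ha [[p hp] [q hq]]]] := ev_ex (ev_and (cls_ev a)
  (ev_and (ev_stage X) (ev_stage Y))).
by have [f ->] := ha _ _ hp hq; rewrite (zidE hq) zcompE comp1m.
Qed.

Lemma zcompm1 X Y (a : zhom X Y) : zcomp a (zid X) = a.
Proof.
have [k [ha [[p hp] [q hq]]]] := ev_ex (ev_and (cls_ev a)
  (ev_and (ev_stage X) (ev_stage Y))).
by have [f ->] := ha _ _ hp hq; rewrite (zidE hp) zcompE compm1.
Qed.

Lemma zcompDl X Y Z (b b' : zhom Y Z) (a : zhom X Y) :
  zcomp (b + b') a = zcomp b a + zcomp b' a.
Proof.
have [k [ha [hb [hc [[p hp] [[q hq] [r hr]]]]]]] := ev_ex
  (ev_and (cls_ev a) (ev_and (cls_ev b) (ev_and (cls_ev b')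
  (ev_and (ev_stage X) (ev_and (ev_stage Y) (ev_stage Z)))))).
have [f ->] := ha _ _ hp hq; have [g ->] := hb _ _ hq hr.
by have [h ->] := hc _ _ hq hr; rewrite !(clsD, zcompE) compDl.
Qed.

Lemma zcompDr X Y Z (b : zhom Y Z) (a a' : zhom X Y) :
  zcomp b (a + a') = zcomp b a + zcomp b a'.
Proof.
have [k [ha [hb [hc [[p hp] [[q hq] [r hr]]]]]]] := ev_ex
  (ev_and (cls_ev a) (ev_and (cls_ev b) (ev_and (cls_ev a')
  (ev_and (ev_stage X) (ev_and (ev_stage Y) (ev_stage Z)))))).
have [f ->] := ha _ _ hp hq; have [g ->] := hb _ _ hq hr.
by have [h ->] := hc _ _ hp hq; rewrite !(clsD, zcompE) compDr.
Qed.

Lemma zzero_obj : exists Z, zero_eqns zhom Z.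
Proof.
have [Z hZ] := zero_ex C; exists (Z, 0) => X.
have idZ p : idm (iter p Omega Z) = 0.
  by elim: p => [|p IH] /=; [exact: (hZ Z).1 | rewrite -fmap1 IH fmap0].
split=> a; have [k [ha [[p hp] [q hq]]]] := ev_ex (ev_and (cls_ev a)
  (ev_and (ev_stage X) (ev_stage (Z, 0)))).
  have [f ->] := ha _ _ hp hq; rewrite (cls0 hp hq); congr cls.
  by rewrite -[LHS]comp1m idZ comp0m.
have [f ->] := ha _ _ hq hp; rewrite (cls0 hq hp); congr cls.
by rewrite -[LHS]compm1 idZ compm0.
Qed.

Lemma zbiproduct_ex X Y : exists P, biproduct_eqns zid zcomp X Y P.
Proof.
have [k [[p hp] [q hq]]] := ev_ex (ev_and (ev_stage X) (ev_stage Y)).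
have [P [i1 [i2 [p1 [p2 [e1 e2 e3 e4 e5]]]]]] :=
  biproduct_ex (iter p Omega X.1) (iter q Omega Y.1).
have hP : stage (P, - k) k 0 by rewrite /stage /=; lia.
exists (P, - k), (cls hp hP i1), (cls hq hP i2), (cls hP hp p1), (cls hP hq p2).
rewrite (zidE hp) (zidE hq) (zidE hP) (cls0 hp hq) (cls0 hq hp) !zcompE clsD.
by rewrite e1 e2 e3 e4 e5.
Qed.

Definition stab_cat : addCat :=
  AddCat zcompA zcomp1m zcompm1 zcompDl zcompDr zzero_obj zbiproduct_ex.

Definition zsh (s : int) (X : zob) : zob := (X.1, X.2 + s).

Lemma stage_sh s X k p : stage X k p -> stage (zsh s X) (k - s) p.
Proof. rewrite /stage /=; lia. Qed.

(* zsh 1 is Om, zsh (-1) is its inverse Sigma. A representative at stage k gives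
   the same morphism of C at stage k - s; zshift_stage below shows that for s = 1
   this is also the class of Om f at stage k. *)
Definition zshift s X Y (a : zhom X Y) : zhom (zsh s X) (zsh s Y) :=
  let b := repr a in
  @cls (zsh s X) (zsh s Y) _ _ _ (stage_sh s (gpP b)) (stage_sh s (gqP b))
    (gmor b).

Lemma zshift_up s X Y k p q (hp : stage X k p) (hq : stage Y k q) f
    k' p' q' (hp' : stage X k' p') (hq' : stage Y k' q') : k <= k' ->
  exists f', cls hp hq f = cls hp' hq' f' /\
    @cls (zsh s X) (zsh s Y) _ _ _ (stage_sh s hp) (stage_sh s hq) f =
    @cls (zsh s X) (zsh s Y) _ _ _ (stage_sh s hp') (stage_sh s hq') f'.
Proof.
move=> /le_stage[r e]; subst k'.
have ep := stage_eq hp hp'; have eq' := stage_eq hq hq'; subst p' q'.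
exists (up f r); split; first exact: cls_up.
have e : k + r%:Z - s = k - s + r%:Z by lia.
move: (stage_sh s hp') (stage_sh s hq'); rewrite e => a b.
exact: (@cls_up (zsh s X) (zsh s Y)).
Qed.

Lemma zshiftE s X Y k p q (hp : stage X k p) (hq : stage Y k q) f :
  zshift s (cls hp hq f) =
  @cls (zsh s X) (zsh s Y) _ _ _ (stage_sh s hp) (stage_sh s hq) f.
Proof.
rewrite /zshift; have := reprK (cls hp hq f).
case: (repr _) => k' p' q' hp' hq' f' /= e.
have [l [hl [hl' [[a ha] [b hb]]]]] := ev_ex (ev_and (ev_ge k)
  (ev_and (ev_ge k') (ev_and (ev_stage X) (ev_stage Y)))).
have [f1 [e1 ->]] := zshift_up s hp hq f ha hb hl.
have [f2 [e2 ->]] := zshift_up s hp' hq' f' ha hb hl'.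
have /cls_eq[r er] : cls ha hb f2 = cls ha hb f1 by rewrite -e2 -e1.
by apply/cls_eq; exists r.
Qed.

Lemma zshift1 s X : zshift s (zid X) = zid (zsh s X).
Proof.
have [k [p hp]] := ev_ex (ev_stage X).
by rewrite (zidE hp) zshiftE (zidE (stage_sh s hp)).
Qed.

Lemma zshiftM s X Y Z (b : zhom Y Z) (a : zhom X Y) :
  zshift s (zcomp b a) = zcomp (zshift s b) (zshift s a).
Proof.
have [k [ha [hb [[p hp] [[q hq] [r hr]]]]]] := ev_ex (ev_and (cls_ev a)
  (ev_and (cls_ev b) (ev_and (ev_stage X) (ev_and (ev_stage Y) (ev_stage Z))))).
have [f ->] := ha _ _ hp hq; have [g ->] := hb _ _ hq hr.
by rewrite zcompE !zshiftE zcompE.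
Qed.

Lemma zshiftD s X Y (a b : zhom X Y) :
  zshift s (a + b) = zshift s a + zshift s b.
Proof.
have [k [ha [hb [[p hp] [q hq]]]]] := ev_ex (ev_and (cls_ev a)
  (ev_and (cls_ev b) (ev_and (ev_stage X) (ev_stage Y)))).
have [f ->] := ha _ _ hp hq; have [g ->] := hb _ _ hp hq.
by rewrite clsD !zshiftE clsD.
Qed.

Definition stab_shift (s : int) : endofunctor stab_cat :=
  @Endofunctor stab_cat (zsh s) (zshift s) (zshift1 s) (zshiftM s) (zshiftD s).

Lemma zshK (s t : int) X : s + t = 0 -> zsh s (zsh t X) = X.
Proof. by case: X => A n h; rewrite /zsh /=; congr pair; lia. Qed.

Lemma eqm_iso (D : addCat) (A B : D) (e : A = B) : is_iso (eqm e).
Proof. by case: B / e; exists (idm A); rewrite comp1m. Qed.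

Lemma eqmE (A : C) (n m : int) (e : (A, n) = (A, m) :> stab_cat) k p
    (hp : stage (A, n) k p) (hq : stage (A, m) k p) :
  eqm e = cls hp hq (idm _).
Proof.
have nm : n = m by case: e.
subst m; rewrite (Prop_irrelevance e erefl) (stage_irr hq hp).
exact: zidE.
Qed.

Lemma zshK_nat (s t : int) (st : s + t = 0) X Y (a : zhom X Y) :
  (a : @hom stab_cat X Y) \oc eqm (zshK X st : _ = X :> stab_cat) =
  eqm (zshK Y st : _ = Y :> stab_cat) \oc fmap (stab_shift s) (fmap (stab_shift t) a).
Proof.
case: X Y a => [A n] [B m] a.
have [k [ha [[p hp] [q hq]]]] := ev_ex (ev_and (cls_ev a)
  (ev_and (ev_stage (A, n)) (ev_stage (B, m)))).
have [f ->] := ha _ _ hp hq.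
rewrite /= !zshiftE.
have e : k - t - s = k by lia.
move: (stage_sh s _) (stage_sh s _); rewrite e => hq' hp'.
by rewrite (eqmE _ hp' hp) (eqmE _ hq' hq) !zcompE comp1m compm1.
Qed.

End Stabilization.

(* (-1)^k x *)
Definition sgm (V : zmodType) (k : int) (x : V) : V := x *~ ((-1) ^+ absz k).

Lemma sgm_cases k :
  (forall (V : zmodType) (x : V), sgm k x = x) \/ (forall (V : zmodType) (x : V), sgm k x = - x).
Proof.
rewrite /sgm -signr_odd; case: odd; [right|left] => V x.
  by rewrite expr1 mulrNz mulr1z.
by rewrite expr0 mulr1z.
Qed.

Lemma sgmS (V : zmodType) k (x : V) : sgm (k + 1) x = - sgm k x.
Proof.
rewrite /sgm -signr_odd -[(-1) ^+ absz k]signr_odd.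
have -> : odd (absz (k + 1)) = ~~ odd (absz k) by lia.
by case: odd; rewrite ?expr0 ?expr1 ?mulrNz ?opprK ?mulr1z.
Qed.

Lemma sgmK (V : zmodType) k (x : V) : sgm k (sgm k x) = x.
Proof. by case: (sgm_cases k) => h; rewrite !h ?opprK. Qed.

Section Triangulation.
Variable C : leftTri.

Notation Omega := (Om C).
Notation zob := (zob C).
Notation zhom := (zhom (Om C)).
Notation zOm := (@zsh C 1).

Lemma stage_Om (X : zob) k p : stage X k p -> stage (zOm X) k p.+1.
Proof. rewrite /stage /=; lia. Qed.

(* Om X1 -> X3 -> X2 -> X1 is induced, at some stage k, by a sequence of C which
   is a triangle after multiplying its three maps by (-1)^k. *)
Definition ztri (X1 X3 X2 : zob) (u : zhom (zOm X1) X3) (v : zhom X3 X2)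
    (w : zhom X2 X1) : Prop :=
  exists k p1 p2 p3 (h1 : stage X1 k p1) (h2 : stage X2 k p2)
      (h3 : stage X3 k p3)
      (u' : hom (Omega (iter p1 Omega X1.1)) (iter p3 Omega X3.1))
      (v' : hom (iter p3 Omega X3.1) (iter p2 Omega X2.1))
      (w' : hom (iter p2 Omega X2.1) (iter p1 Omega X1.1)),
    [/\ u = @cls C Omega (zOm X1) X3 k p1.+1 p3 (stage_Om h1) h3 u',
        v = cls h3 h2 v', w = cls h2 h1 w'
      & tri (sgm k u') (sgm k v') (sgm k w')].

Lemma is_iso1 (D : addCat) (A : D) : is_iso (idm A).
Proof. by exists (idm A); rewrite comp1m. Qed.

Lemma is_isoN1 (A : C) : is_iso (- idm A).
Proof. by exists (- idm A); rewrite compNm compmN opprK comp1m. Qed.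

Lemma tri_vw (A B D : C) (u : hom (Omega D) A) (v : hom A B) (w : hom B D) :
  tri u v w -> tri u (- v) (- w).
Proof.
apply: tri_iso (is_iso1 A) (is_isoN1 B) (is_iso1 D) _ _ _.
- by rewrite fmap1 comp1m compm1.
- by rewrite compNm comp1m compm1.
- by rewrite comp1m compNm compmN compm1 opprK.
Qed.

Lemma tri_uw (A B D : C) (u : hom (Omega D) A) (v : hom A B) (w : hom B D) :
  tri u v w -> tri (- u) v (- w).
Proof.
apply: tri_iso (is_iso1 A) (is_iso1 B) (is_isoN1 D) _ _ _.
- by rewrite fmapN fmap1 comp1m compNm compmN compm1 opprK.
- by rewrite comp1m compm1.
- by rewrite compNm comp1m compm1.
Qed.

Lemma tri_uv (A B D : C) (u : hom (Omega D) A) (v : hom A B) (w : hom B D) :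
  tri u v w -> tri (- u) (- v) w.
Proof.
apply: tri_iso (is_isoN1 A) (is_iso1 B) (is_iso1 D) _ _ _.
- by rewrite fmap1 compNm comp1m compm1.
- by rewrite comp1m compNm compmN compm1 opprK.
- by rewrite comp1m compm1.
Qed.

Lemma tri_fmap k (A B D : C) (u : hom (Omega D) A) (v : hom A B) (w : hom B D) :
  tri (sgm k u) (sgm k v) (sgm k w) ->
  tri (sgm (k + 1) (fmap Omega u)) (sgm (k + 1) (fmap Omega v))
      (sgm (k + 1) (fmap Omega w)).
Proof.
move=> /tri_rot/tri_rot/tri_rot; rewrite !sgmS.
by case: (sgm_cases k) => h; rewrite !h ?fmapN.
Qed.

Lemma tri_stage_up k r (X1 X3 X2 : zob) p1 p2 p3 (h1 : stage X1 k p1)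
    (h2 : stage X2 k p2) (h3 : stage X3 k p3)
    (u : hom (Omega (iter p1 Omega X1.1)) (iter p3 Omega X3.1))
    (v : hom (iter p3 Omega X3.1) (iter p2 Omega X2.1))
    (w : hom (iter p2 Omega X2.1) (iter p1 Omega X1.1)) :
  tri (sgm k u) (sgm k v) (sgm k w) ->
  forall q1 q2 q3 (g1 : stage X1 (k + r%:Z) q1)
    (g2 : stage X2 (k + r%:Z) q2) (g3 : stage X3 (k + r%:Z) q3),
  exists u' v' w',
    [/\ @cls C Omega (zOm X1) X3 k p1.+1 p3 (stage_Om h1) h3 u =
        @cls C Omega (zOm X1) X3 (k + r%:Z) q1.+1 q3 (stage_Om g1) g3 u',
      cls h3 h2 v = cls g3 g2 v', cls h2 h1 w = cls g2 g1 w'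
    & tri (sgm (k + r%:Z) u') (sgm (k + r%:Z) v') (sgm (k + r%:Z) w')].
Proof.
elim: r k p1 p2 p3 h1 h2 h3 u v w => [|r IH] k p1 p2 p3 h1 h2 h3 u v w t.
  have e : k + 0%:Z = k by lia.
  rewrite e => q1 q2 q3 g1 g2 g3.
  have e1 := stage_fun h1 g1; have e2 := stage_fun h2 g2.
  have e3 := stage_fun h3 g3; subst q1 q2 q3.
  by exists u, v, w; rewrite (stage_irr g1 h1) (stage_irr g2 h2)
    (stage_irr g3 h3).
have e : k + r.+1%:Z = (k + 1) + r%:Z by lia.
rewrite e => q1 q2 q3 g1 g2 g3.
have [u' [v' [w' [e1 e2 e3 t']]]] := IH (k + 1) _ _ _ (stageS h1) (stageS h2)
  (stageS h3) _ _ _ (tri_fmap t) _ _ _ g1 g2 g3.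
exists u', v', w'; split=> //; [rewrite -e1|rewrite -e2|rewrite -e3];
  exact: cls_step.
Qed.

Lemma ztri_ev (X1 X3 X2 : zob) (u : zhom (zOm X1) X3) (v : zhom X3 X2)
    (w : zhom X2 X1) : ztri u v w ->
  ev (fun k => forall q1 q2 q3 (g1 : stage X1 k q1)
    (g2 : stage X2 k q2) (g3 : stage X3 k q3),
  exists u' v' w',
    [/\ u = @cls C Omega (zOm X1) X3 k q1.+1 q3 (stage_Om g1) g3 u',
      v = cls g3 g2 v', w = cls g2 g1 w'
    & tri (sgm k u') (sgm k v') (sgm k w')]).
Proof.
move=> [k [p1 [p2 [p3 [h1 [h2 [h3 [u' [v' [w' [-> -> -> t]]]]]]]]]]].
have [N hN] := ev_ge k; exists N => k' /hN/le_stage[r ->].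
exact: tri_stage_up t.
Qed.

(* Equality after r applications of Om *)
Fixpoint eqr r : forall A B : C, hom A B -> hom A B -> Prop :=
  match r with
  | 0 => fun A B f g => f = g
  | r'.+1 => fun A B f g => eqr r' (fmap Omega f) (fmap Omega g)
  end.

Lemma eqr_eq r (A B : C) (f g : hom A B) : f = g -> eqr r f g.
Proof. by move=> ->; elim: r A B {f} g => //= r IH A B g; apply: IH. Qed.

Lemma eqr_add r s (A B : C) (f g : hom A B) : eqr r f g -> eqr (r + s) f g.
Proof.
elim: r A B f g => [|r IH] A B f g /=; first exact: eqr_eq.
exact: IH.
Qed.

Lemma cls_eqr (X Y : zob) k p q (hp : stage X k p) (hq : stage Y k q)
    (f f' : hom (iter p Omega X.1) (iter q Omega Y.1)) :
  cls hp hq f = cls hp hq f' -> exists r, eqr r f f'.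
Proof.
move=> /cls_eq[r].
have hr : stage X (k + r%:Z) (r + p) by have := hp; rewrite /stage; lia.
have hr' : stage Y (k + r%:Z) (r + q) by have := hq; rewrite /stage; lia.
move=> e; exists r; have := iter_gstep hp hq f hr hr'.
rewrite e -(iter_gstep hp hq f' hr hr') {e hr hr'}.
elim: r k p q hp hq f f' => [|r IH] k p q hp hq f f'.
  by move=> /= /Germ_inj.
by rewrite !iterSr => /IH.
Qed.

Lemma ztri_iso_aux r (X1 X3 X2 Y1 Y3 Y2 : zob) k p1 p2 p3 q1 q2 q3
  (h1 : stage X1 k p1) (h2 : stage X2 k p2) (h3 : stage X3 k p3)
  (g1 : stage Y1 k q1) (g2 : stage Y2 k q2) (g3 : stage Y3 k q3)
  (u : hom (Omega (iter p1 Omega X1.1)) (iter p3 Omega X3.1))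
  (v : hom (iter p3 Omega X3.1) (iter p2 Omega X2.1))
  (w : hom (iter p2 Omega X2.1) (iter p1 Omega X1.1))
  (u' : hom (Omega (iter q1 Omega Y1.1)) (iter q3 Omega Y3.1))
  (v' : hom (iter q3 Omega Y3.1) (iter q2 Omega Y2.1))
  (w' : hom (iter q2 Omega Y2.1) (iter q1 Omega Y1.1))
  (a1 : hom (iter p1 Omega X1.1) (iter q1 Omega Y1.1))
  (a2 : hom (iter p2 Omega X2.1) (iter q2 Omega Y2.1))
  (a3 : hom (iter p3 Omega X3.1) (iter q3 Omega Y3.1))
  (b1 : hom (iter q1 Omega Y1.1) (iter p1 Omega X1.1))
  (b2 : hom (iter q2 Omega Y2.1) (iter p2 Omega X2.1))
  (b3 : hom (iter q3 Omega Y3.1) (iter p3 Omega X3.1)) :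
  [/\ eqr r (b1 \oc a1) (idm _), eqr r (b2 \oc a2) (idm _)
    & eqr r (b3 \oc a3) (idm _)] ->
  [/\ eqr r (a1 \oc b1) (idm _), eqr r (a2 \oc b2) (idm _)
    & eqr r (a3 \oc b3) (idm _)] ->
  [/\ eqr r (a3 \oc u) (u' \oc fmap Omega a1), eqr r (a2 \oc v) (v' \oc a3)
    & eqr r (a1 \oc w) (w' \oc a2)] ->
  tri (sgm k u) (sgm k v) (sgm k w) ->
  ztri (@cls C Omega (zOm Y1) Y3 k q1.+1 q3 (stage_Om g1) g3 u')
    (cls g3 g2 v') (cls g2 g1 w').
Proof.
elim: r k p1 p2 p3 q1 q2 q3 h1 h2 h3 g1 g2 g3 u v w u' v' w'
    a1 a2 a3 b1 b2 b3 => [|r IH] k p1 p2 p3 q1 q2 q3 h1 h2 h3 g1 g2 g3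
    u v w u' v' w' a1 a2 a3 b1 b2 b3 [ba1 ba2 ba3] [ab1 ab2 ab3] [eu ev' ew] t.
  exists k, q1, q2, q3, g1, g2, g3, u', v', w'; split=> //.
  apply: (tri_iso (f := a3) (g := a2) (h := a1) _ _ _ _ _ _ t).
  - by exists b3.
  - by exists b2.
  - by exists b1.
  - by case: (sgm_cases k) => h; rewrite !h ?compNm ?compmN eu.
  - by case: (sgm_cases k) => h; rewrite !h ?compNm ?compmN ev'.
  - by case: (sgm_cases k) => h; rewrite !h ?compNm ?compmN ew.
rewrite (cls_step (stage_Om g1) g3 u' (stage_Om (stageS g1)) (stageS g3)).
rewrite (cls_step g3 g2 v' (stageS g3) (stageS g2)).
rewrite (cls_step g2 g1 w' (stageS g2) (stageS g1)).
apply: (IH _ _ _ _ _ _ _ (stageS h1) (stageS h2) (stageS h3)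
  (stageS g1) (stageS g2) (stageS g3) (fmap Omega u) (fmap Omega v)
  (fmap Omega w) (fmap Omega u') (fmap Omega v') (fmap Omega w')
  (fmap Omega a1) (fmap Omega a2) (fmap Omega a3)
  (fmap Omega b1) (fmap Omega b2) (fmap Omega b3)); last exact: tri_fmap.
- by split; rewrite -fmapM -fmap1.
- by split; rewrite -fmapM -fmap1.
- by split; rewrite -!fmapM.
Qed.

(* Representatives at stage k of a morphism f together with an inverse *)
Lemma is_iso_ev (X Y : zob) (f : @hom (stab_cat Omega) X Y) : is_iso f ->
  ev (fun k => forall p q (hp : stage X k p) (hq : stage Y k q),
   exists a b r, [/\ f = cls hp hq a, eqr r (b \oc a) (idm _)
     & eqr r (a \oc b) (idm _)]).
Proof.
move=> [g [gf fg]].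
have [N hN] := ev_and (cls_ev f) (cls_ev g).
exists N => k /hN[hf hg] p q hp hq.
have [a fE] := hf p q hp hq; have [b gE] := hg q p hq hp.
move: gf fg; rewrite fE gE /= (zidE Omega hp) (zidE Omega hq) !zcompE.
move=> /cls_eqr[r er] /cls_eqr[s es]; exists a, b, (r + s)%N; split=> //.
  exact: eqr_add.
by rewrite addnC; apply: eqr_add.
Qed.

Lemma zshift_stage (X Y : zob) k p q (hp : stage X k p) (hq : stage Y k q)
    (f : hom (iter p Omega X.1) (iter q Omega Y.1)) :
  zshift 1 (cls hp hq f) = @cls C Omega (zOm X) (zOm Y) k _ _ (stage_Om hp)
    (stage_Om hq) (fmap Omega f).
Proof.
rewrite zshiftE; have e : k = k - 1 + 1 by lia.
move: (k - 1) e (stage_sh 1 hp) (stage_sh 1 hq) (stage_Om hp) (stage_Om hq).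
move=> l e; rewrite e => *; exact: cls_step.
Qed.

Local Notation SC := (stab_cat Omega).

Lemma ztri_iso (X1 X3 X2 Y1 Y3 Y2 : SC)
    (u : hom (stab_shift Omega 1 X1) X3) (v : hom X3 X2) (w : hom X2 X1)
    (u' : hom (stab_shift Omega 1 Y1) Y3) (v' : hom Y3 Y2) (w' : hom Y2 Y1)
    (f : hom X3 Y3) (g : hom X2 Y2) (h : hom X1 Y1) :
  is_iso f -> is_iso g -> is_iso h ->
  f \oc u = u' \oc fmap (stab_shift Omega 1) h -> g \oc v = v' \oc f ->
  h \oc w = w' \oc g ->
  ztri u v w -> ztri u' v' w'.
Proof.
move=> /is_iso_ev hf /is_iso_ev hg /is_iso_ev hh eu ev' ew /ztri_ev ht.
have [k [[k1 k2] [[k3 k4] [[k5 k6] [[k7 k8] [[k9 k10] [k11 k12]]]]]]] := ev_ex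
  (ev_and (ev_and hf hg) (ev_and (ev_and hh ht) (ev_and (ev_and (cls_ev u')
  (cls_ev v')) (ev_and (ev_and (cls_ev w') (ev_stage X1)) (ev_and
  (ev_and (ev_stage X2) (ev_stage X3)) (ev_and (ev_stage Y1)
  (ev_and (ev_stage Y2) (ev_stage Y3)))))))).
case: k8 => p1 h1; case: k9 => p2 h2; case: k10 => p3 h3.
case: k11 => q1 g1; case: k12 => -[q2 g2] [q3 g3].
have [a3 [b3 [r3 [fE ba3 ab3]]]] := k1 _ _ h3 g3.
have [a2 [b2 [r2 [gE ba2 ab2]]]] := k2 _ _ h2 g2.
have [a1 [b1 [r1 [hE ba1 ab1]]]] := k3 _ _ h1 g1.
have [u1 [v1 [w1 [uE vE wE t]]]] := k4 _ _ _ h1 h2 h3.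
have [u2 uE'] := k5 _ _ (stage_Om g1) g3.
have [v2 vE'] := k6 _ _ g3 g2; have [w2 wE'] := k7 _ _ g2 g1.
move: eu ev' ew; rewrite fE gE hE uE vE wE uE' vE' wE' /= zshift_stage.
rewrite !zcompE.
move=> /cls_eqr[s3 e3] /cls_eqr[s2 e2] /cls_eqr[s1 e1].
pose R := (r1 + r2 + r3 + s1 + s2 + s3)%N.
have mono r (A B : C) (x y : hom A B) : (r <= R)%N -> eqr r x y -> eqr R x y.
  by move=> /subnKC <-; apply: eqr_add.
apply: (@ztri_iso_aux R _ _ _ _ _ _ k _ _ _ _ _ _ h1 h2 h3 g1 g2 g3
  u1 v1 w1 u2 v2 w2 a1 a2 a3 b1 b2 b3) => //; split.
- by apply: mono ba1; rewrite /R; lia.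
- by apply: mono ba2; rewrite /R; lia.
- by apply: mono ba3; rewrite /R; lia.
- by apply: mono ab1; rewrite /R; lia.
- by apply: mono ab2; rewrite /R; lia.
- by apply: mono ab3; rewrite /R; lia.
- by apply: mono e3; rewrite /R; lia.
- by apply: mono e2; rewrite /R; lia.
- by apply: mono e1; rewrite /R; lia.
Qed.

Lemma zero_stage (Z : SC) : is_zero Z ->
  ev (fun k => forall p, stage Z k p -> idm (iter p Omega Z.1) = 0).
Proof.
move=> hZ; have [k [p hp]] := ev_ex (ev_stage Z).
have := (hZ Z).1 (zid Omega Z).
rewrite (zidE Omega hp) [0](cls0 Omega hp hp) => /cls_eq[r].
rewrite up1 up0 => e.
have [N hN] := ev_ge (k + r%:Z); exists N => k' /hN/le_stage[s ->] p' hp'.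
have -> : p' = (s + (r + p))%N by move: hp hp'; rewrite /stage; lia.
by rewrite -up1 e up0.
Qed.

Lemma ztri_id (X Z : SC) : is_zero Z ->
  ztri (0 : hom (stab_shift Omega 1 Z) X) (idm X) (0 : hom X Z).
Proof.
move=> /zero_stage hZ.
have [k [h [[p hp] [q hq]]]] := ev_ex (ev_and hZ (ev_and (ev_stage X)
  (ev_stage Z))).
have hz : is_zero (iter q Omega Z.1 : C).
  move=> A; split=> f; first by rewrite -[LHS]comp1m h // comp0m.
  by rewrite -[LHS]compm1 h // compm0.
exists k, q, p, p, hq, hp, hp, 0, (idm _), 0; split.
- exact: cls0.
- exact: zidE.
- exact: cls0.
- case: (sgm_cases k) => e; rewrite !e ?oppr0; first exact: tri_id.
  by rewrite -[X in tri _ _ X]oppr0; apply/tri_vw/tri_id.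
Qed.

Lemma ztri_ex (X2 X1 : SC) (w : hom X2 X1) :
  exists (X3 : SC) (u : hom (stab_shift Omega 1 X1) X3) (v : hom X3 X2),
    ztri u v w.
Proof.
have [k [hw [[p1 h1] [p2 h2]]]] := ev_ex (ev_and (cls_ev w)
  (ev_and (ev_stage X1) (ev_stage X2))).
have [w' ->] := hw _ _ h2 h1.
have [A [u [v t]]] := tri_ex (sgm k w').
have h3 : stage ((A, - k) : zob) k 0 by rewrite /stage /=; lia.
exists (A, - k), (@cls C Omega (zOm X1) (A, - k) k p1.+1 0 (stage_Om h1) h3
  (sgm k u)), (@cls C Omega (A, - k) X2 k 0 p2 h3 h2 (sgm k v)).
exists k, p1, p2, 0%N, h1, h2, h3, (sgm k u), (sgm k v), w'; split=> //.
by rewrite !sgmK.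
Qed.

Lemma ztri_rot (X1 X3 X2 : SC) (u : hom (stab_shift Omega 1 X1) X3)
    (v : hom X3 X2) (w : hom X2 X1) :
  ztri u v w -> ztri (- fmap (stab_shift Omega 1) w) u v.
Proof.
move=> [k [p1 [p2 [p3 [h1 [h2 [h3 [u' [v' [w' [-> -> -> t]]]]]]]]]]].
exists k, p2, p3, p1.+1, h2, h3, (stage_Om h1), (- fmap Omega w'), u', v'.
split=> //; first by rewrite /= zshift_stage; apply: clsN.
by have := tri_rot t; case: (sgm_cases k) => e; rewrite !e ?fmapN.
Qed.

Lemma ztri_mor_aux r (X1 X3 X2 Y1 Y3 Y2 : zob) k p1 p2 p3 q1 q2 q3
  (h1 : stage X1 k p1) (h2 : stage X2 k p2) (h3 : stage X3 k p3)
  (g1 : stage Y1 k q1) (g2 : stage Y2 k q2) (g3 : stage Y3 k q3)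
  (u : hom (Omega (iter p1 Omega X1.1)) (iter p3 Omega X3.1))
  (v : hom (iter p3 Omega X3.1) (iter p2 Omega X2.1))
  (w : hom (iter p2 Omega X2.1) (iter p1 Omega X1.1))
  (u' : hom (Omega (iter q1 Omega Y1.1)) (iter q3 Omega Y3.1))
  (v' : hom (iter q3 Omega Y3.1) (iter q2 Omega Y2.1))
  (w' : hom (iter q2 Omega Y2.1) (iter q1 Omega Y1.1))
  (a1 : hom (iter p1 Omega X1.1) (iter q1 Omega Y1.1))
  (a2 : hom (iter p2 Omega X2.1) (iter q2 Omega Y2.1)) :
  eqr r (a1 \oc w) (w' \oc a2) ->
  tri (sgm k u) (sgm k v) (sgm k w) -> tri (sgm k u') (sgm k v') (sgm k w') ->
  exists f : zhom X3 Y3,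
    zcomp f (@cls C Omega (zOm X1) X3 k p1.+1 p3 (stage_Om h1) h3 u) =
    zcomp (@cls C Omega (zOm Y1) Y3 k q1.+1 q3 (stage_Om g1) g3 u')
      (@cls C Omega (zOm X1) (zOm Y1) k _ _ (stage_Om h1) (stage_Om g1)
        (fmap Omega a1)) /\
    zcomp (cls h2 g2 a2) (cls h3 h2 v) = zcomp (cls g3 g2 v') f.
Proof.
elim: r k p1 p2 p3 q1 q2 q3 h1 h2 h3 g1 g2 g3 u v w u' v' w'
    a1 a2 => [|r IH] k p1 p2 p3 q1 q2 q3 h1 h2 h3 g1 g2 g3
    u v w u' v' w' a1 a2 ew t t'.
  have [] := tri_mor (g := a2) (h := a1) t t'.
    by case: (sgm_cases k) => h; rewrite !h ?compNm ?compmN ew.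
  move=> f [fu fv]; exists (cls h3 g3 f); rewrite !zcompE.
  move: fu fv; case: (sgm_cases k) => h; rewrite !h ?compNm ?compmN.
    by move=> -> ->.
  by move=> /oppr_inj -> /oppr_inj ->.
have [] := IH _ _ _ _ _ _ _ (stageS h1) (stageS h2) (stageS h3) (stageS g1)
  (stageS g2) (stageS g3) (fmap Omega u) (fmap Omega v) (fmap Omega w)
  (fmap Omega u') (fmap Omega v') (fmap Omega w') (fmap Omega a1)
  (fmap Omega a2) _ (tri_fmap t) (tri_fmap t'); first by rewrite -!fmapM.
move=> f [fu fv]; exists f.
rewrite (cls_step (stage_Om h1) h3 u (stage_Om (stageS h1)) (stageS h3)).
rewrite (cls_step (stage_Om g1) g3 u' (stage_Om (stageS g1)) (stageS g3)).
rewrite (cls_step (stage_Om h1) (stage_Om g1) _ (stage_Om (stageS h1))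
  (stage_Om (stageS g1))).
rewrite (cls_step h3 h2 v (stageS h3) (stageS h2)).
rewrite (cls_step g3 g2 v' (stageS g3) (stageS g2)).
by rewrite (cls_step h2 g2 a2 (stageS h2) (stageS g2)).
Qed.

Lemma ztri_mor (X1 X3 X2 Y1 Y3 Y2 : SC)
    (u : hom (stab_shift Omega 1 X1) X3) (v : hom X3 X2) (w : hom X2 X1)
    (u' : hom (stab_shift Omega 1 Y1) Y3) (v' : hom Y3 Y2) (w' : hom Y2 Y1)
    (g : hom X2 Y2) (h : hom X1 Y1) :
  ztri u v w -> ztri u' v' w' -> h \oc w = w' \oc g ->
  exists f : hom X3 Y3,
    f \oc u = u' \oc fmap (stab_shift Omega 1) h /\ g \oc v = v' \oc f.
Proof.
move=> /ztri_ev ht /ztri_ev ht' ew.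
have [k [[k3 k4] [[k5 k6] [[k8 [k9 k10]] [k11 k12]]]]] := ev_ex
  (ev_and (ev_and ht ht') (ev_and (ev_and (cls_ev g)
  (cls_ev h)) (ev_and (ev_and (ev_stage X1)
  (ev_and (ev_stage X2) (ev_stage X3))) (ev_and (ev_stage Y1)
  (ev_and (ev_stage Y2) (ev_stage Y3)))))).
case: k8 => p1 h1; case: k9 => p2 h2; case: k10 => p3 h3.
case: k11 => q1 g1; case: k12 => -[q2 g2] [q3 g3].
have [u1 [v1 [w1 [uE vE wE t]]]] := k3 _ _ _ h1 h2 h3.
have [u2 [v2 [w2 [uE' vE' wE' t']]]] := k4 _ _ _ g1 g2 g3.
have [a2 gE] := k5 _ _ h2 g2; have [a1 hE] := k6 _ _ h1 g1.
move: ew; rewrite gE hE uE vE wE uE' vE' wE' /= zshift_stage => ew.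
have [r er] : exists r, eqr r (a1 \oc w1) (w2 \oc a2).
  by apply: (@cls_eqr _ _ _ _ _ h2 g1); rewrite -!zcompE.
exact: (ztri_mor_aux h1 h2 h3 g1 g2 g3 er t t').
Qed.

Lemma ztri_oct (XA XB XC XD XE : SC)
    (u : hom (stab_shift Omega 1 XC) XA) (v : hom XA XB) (w : hom XB XC)
    (f : hom (stab_shift Omega 1 XD) XE) (g : hom XE XC) (h : hom XC XD) :
  ztri u v w -> ztri f g h ->
  exists (XF : SC) (i : hom (stab_shift Omega 1 XD) XF) (j : hom XF XB)
         (al : hom XA XF) (be : hom XF XE),
    [/\ ztri i j (h \oc w), ztri (u \oc fmap (stab_shift Omega 1) g) al be
      & [/\ al \oc u = i \oc fmap (stab_shift Omega 1) h, j \oc al = v,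
            be \oc i = f & g \oc be = w \oc j]].
Proof.
move=> /ztri_ev ht /ztri_ev ht'.
have [k [[k1 k2] [[[a ha] [b hb]] [[c hc] [[d hd] [e he]]]]]] := ev_ex
  (ev_and (ev_and ht ht') (ev_and (ev_and (ev_stage XA) (ev_stage XB))
  (ev_and (ev_stage XC) (ev_and (ev_stage XD) (ev_stage XE))))).
have [u1 [v1 [w1 [-> -> -> t]]]] := k1 _ _ _ hc hb ha.
have [f1 [g1 [h1 [-> -> -> t']]]] := k2 _ _ _ hd hc he.
have [F [i [j [al [be [ti ta [e1 e2 e3 e4]]]]]]] := tri_oct t t'.
have hF : stage ((F, - k) : zob) k 0 by rewrite /stage /=; lia.
have [i' [j' [al' [be' [s1 s2 [s3 s4 s5 s6]]]]]] :
  exists (i' : hom (Omega (iter d Omega XD.1)) F)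
   (j' : hom F (iter b Omega XB.1)) (al' : hom (iter a Omega XA.1) F)
   (be' : hom F (iter e Omega XE.1)),
  [/\ tri (sgm k i') (sgm k j') (sgm k (h1 \oc w1)),
    tri (sgm k (u1 \oc fmap Omega g1)) (sgm k al') (sgm k be')
    & [/\ al' \oc u1 = i' \oc fmap Omega h1, j' \oc al' = v1,
            be' \oc i' = f1 & g1 \oc be' = w1 \oc j']].
  case: (sgm_cases k) => s; rewrite !s in ti ta e1 e2 e3 e4.
    by exists i, j, al, be; rewrite !s.
  exists i, (- j), al, (- be); rewrite !s ?opprK; split.
  - by move: ti; rewrite compNm compmN opprK => /tri_uw.
  - by move: ta; rewrite fmapN compNm compmN opprK => /tri_uv.
  - move: e1 e2 e3 e4; rewrite !(fmapN, compNm, compmN).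
    by move=> /oppr_inj -> -> -> /oppr_inj ->; rewrite !opprK.
exists (F, - k), (@cls C Omega (zOm XD) (F, - k) k d.+1 0 (stage_Om hd) hF i'),
  (@cls C Omega (F, - k) XB k 0 b hF hb j'),
  (@cls C Omega XA (F, - k) k a 0 ha hF al'),
  (@cls C Omega (F, - k) XE k 0 e hF he be').
rewrite /= !zshift_stage !zcompE s3 s4 s5 s6; split=> //.
- by exists k, d, b, 0%N, hd, hb, hF, i', j', (h1 \oc w1).
- by exists k, e, 0%N, a, he, hF, ha, (u1 \oc fmap Omega g1), al', be'.
Qed.

End Triangulation.

Definition stab_ltri (C : leftTri) : leftTri :=
  @LeftTri (stab_cat (Om C)) (stab_shift (Om C) 1) (@ztri C) (@ztri_iso C)
    (@ztri_id C) (@ztri_ex C) (@ztri_rot C) (@ztri_mor C) (@ztri_oct C).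

Definition stab (C : leftTri) : triCat :=
  @TriCat (stab_ltri C) (stab_shift (Om C) (-1))
    (fun X => eqm (zshK X (addrN 1) : _ = X :> stab_cat (Om C)))
    (fun X => eqm_iso _) (@zshK_nat _ (Om C) 1 (-1) (addrN 1))
    (fun X => eqm (zshK X (addNr 1) : _ = X :> stab_cat (Om C)))
    (fun X => eqm_iso _) (@zshK_nat _ (Om C) (-1) 1 (addNr 1)).

Section Angles.
Variable C : leftTri.
Notation Omega := (Om C).

(* Om^i K_1 -> Om^(i-1) K_2 -> ... -> Om K_i -> K_(i+1) *)
Fixpoint connecting (K : nat -> C) (u : forall i, hom (Omega (K i)) (K i.+1))
    (i : nat) : hom (iter i Omega (K 1%N)) (K i.+1) :=
  match i with
  | 0 => idm (K 1%N)
  | j.+1 => u j.+1 \oc fmap Omega (connecting u j)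
  end.

(* The sequence
     Om^d A_1 -last-> A_(d+2) -alpha_(d+1)-> A_(d+1) -> ... -alpha_1-> A_1.
   Families are indexed by all of nat, but indices start at 1: the entries at 0
   and those beyond the range of the sequence play no role. *)
Definition is_angle (d : nat) (A : nat -> C)
    (alpha : forall i, hom (A i.+1) (A i))
    (last : hom (iter d Omega (A 1%N)) (A d.+2)) : Prop :=
  exists (K : nat -> C)
    (u : forall i, hom (Omega (K i)) (K i.+1))
    (v : forall i, hom (K i.+1) (A i.+1))
    (w : forall i, hom (A i.+1) (K i))
    (e1 : K 1%N = A 1%N) (e2 : K d.+1 = A d.+2),
    [/\ forall i, (1 <= i <= d)%N -> tri (u i) (v i) (w i),
        alpha 1%N = eqm e1 \oc w 1%N,
        alpha d.+1 \oc eqm e2 = v d,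
        forall i, (1 <= i < d)%N -> alpha i.+1 = v i \oc w i.+1
      & last \oc eqm (congr1 (iter d Omega) e1) = eqm e2 \oc connecting u d].

End Angles.

Definition hom_zero (C : addCat) (A B : C) : Prop :=
  forall f : hom A B, f = 0.

(* Full subcategories are given by their objects. *)

Definition additive_sub (C : addCat) (X : C -> Prop) : Prop :=
  (exists Z, is_zero Z /\ X Z) /\
  (forall A B, X A -> X B -> exists P, is_biproduct A B P /\ X P).

Definition summand_closed (C : addCat) (X : C -> Prop) : Prop :=
  forall A B P, is_biproduct A B P -> X P -> X A.

Definition left_ct (d : nat) (C : leftTri) (X : C -> Prop) : Prop :=
  [/\ additive_sub X,
      summand_closed X,
      forall M : C,
        (* 0 -> M -> X^1 -> ... -> X^d -> 0 *)
        (exists A alpha last,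
          [/\ @is_angle C d A alpha last, is_zero (A 1%N), A d.+2 = M
            & forall i, (2 <= i <= d.+1)%N -> X (A i)]) /\
        (* 0 -> X_d -> ... -> X_1 -> M -> 0 *)
        (exists A alpha last,
          [/\ @is_angle C d A alpha last, is_zero (A 1%N), A 2%N = M
            & forall i, (3 <= i <= d.+2)%N -> X (A i)]),
      forall (M N : C) i, X N -> (1 <= i <= d.-1)%N ->
        bijective (fun f : hom (iter i.-1 (Om C) N) M => fmap (Om C) f)
    & forall (M N : C) i, X M -> X N -> (1 <= i <= d.-1)%N ->
        hom_zero (iter i (Om C) N) M].

Definition left_dZct (d : nat) (C : leftTri) (X : C -> Prop) : Prop :=
  left_ct d X /\ forall M : C, X M -> X (iter d (Om C) M).

Definition right_approx (C : addCat) (X : C -> Prop) (M : C) : Prop :=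
  exists (N : C) (f : hom N M), X N /\
    forall (N' : C) (g : hom N' M), X N' -> exists h : hom N' N, g = f \oc h.

Definition left_approx (C : addCat) (X : C -> Prop) (M : C) : Prop :=
  exists (N : C) (f : hom M N), X N /\
    forall (N' : C) (g : hom M N'), X N' -> exists h : hom N N', g = h \oc f.

Definition functorially_finite (C : addCat) (X : C -> Prop) : Prop :=
  forall M : C, left_approx X M /\ right_approx X M.

Definition tri_ct (d : nat) (T : triCat) (X : T -> Prop) : Prop :=
  [/\ functorially_finite X,
      forall M : T, X M <->
        forall (N : T) (i : nat), X N -> (1 <= i <= d.-1)%N ->
          hom_zero M (shiftz i N)
    & forall M : T, X M <->
        forall (N : T) (i : nat), X N -> (1 <= i <= d.-1)%N ->
          hom_zero N (shiftz i M)].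

Definition tri_dZct (d : nat) (T : triCat) (X : T -> Prop) : Prop :=
  tri_ct d X /\
  forall (M N : T) (i : int), X M -> X N -> ~~ (d %| i)%Z ->
    hom_zero M (shiftz i N).

Definition dZsub (d : nat) (C : leftTri) (X : C -> Prop) (Y : stab C) : Prop :=
  exists (M : C) (k : int), X M /\ isomorphic Y ((M, d%:Z * k) : stab C).

(* Main.v *)
From mathcomp Require Import all_boot all_order all_algebra.
From mathcomp Require Import zify.
Require Import Defs.

Set Implicit Arguments.
Unset Strict Implicit.
Unset Printing Implicit Defensive.

Import GRing.Theory.
Local Open Scope ring_scope.

(** Three facts about the full subcategory dZX of the stabilization carry the
    proof.

    - Vanishing ([dZsub_hom_zero]). A morphism from (A, dk) to a shift of
      (B, dl) by i not divisible by d is represented at a stage divisible by d,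
      that is, by a morphism from an object of X to some Om^q B with d not
      dividing q. Applying Om between 1 and d - 1 further times makes the target
      an object of X again, and then the representative is zero because
      Hom (Om^r X, X) = 0 for 0 < r < d. So the class is zero.
    - Resolutions. A (d+2)-angle is a chain of d triangles. When its last object
      is 0, the first triangle is an isomorphism, and the other d - 1 form a
      resolution or a coresolution of length d - 1 ([left_ct_resolved],
      [left_ct_coresolved]). Placing a triangle of C in a fixed degree gives
      a triangle of the stabilization up to signs, so resolutions pass from C to
      the objects (M, n) with d dividing n. Every object is isomorphic
      to one of these: (A, n) is (Om^p A, n - p), and p can be chosen with n - p
      divisible by d ([stab_normal_form]).
    - Retracts ([dZsub_retract]). If (A, n) is a retract of an object of dZX,
      then at a large stage divisible by d some Om^p A is a retract of an object
      of X. In a left triangulated category a retract is a direct summand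
      ([retract_summand]), so Om^p A is in X and (A, n) is in dZX.

    By a general principle on triangulated categories ([tri_ct_of_resolutions]),
    a subcategory closed under retracts, without self-extensions in degrees
    1, ..., d - 1, and such that every object has a resolution and a coresolution
    of length d - 1, is d-cluster tilting: dimension shifting along a resolution
    of M shows that its last map B -> M is not only an approximation, but that
    every map Z -> M factors through it as soon as Z has no extensions by the
    subcategory. For Z = M and the identity of M this makes M a retract of B. *)

(** * Retracts and isomorphic objects *)

Definition retract (C : addCat) (A B : C) : Prop :=
  exists (s : hom A B) (r : hom B A), r \oc s = idm A.

Definition retract_closed (C : addCat) (X : C -> Prop) : Prop :=
  forall A B, retract A B -> X B -> X A.

Lemma isomorphic_refl (C : addCat) (A : C) : isomorphic A A.
Proof. by exists (idm A); apply: is_iso1. Qed.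

Lemma isomorphic_sym (C : addCat) (A B : C) :
  isomorphic A B -> isomorphic B A.
Proof. by case=> f [g [gf fg]]; exists g, f. Qed.

Lemma isomorphic_retract (C : addCat) (A B : C) :
  isomorphic A B -> retract A B.
Proof. by case=> f [g [gf _]]; exists f, g. Qed.

Lemma retract_trans (C : addCat) (A B D : C) :
  retract A B -> retract B D -> retract A D.
Proof.
case=> s [r rs] [s' [r' rs']]; exists (s' \oc s), (r \oc r').
by rewrite compA -(compA r r' s') rs' compm1.
Qed.

Lemma iso_epi (C : addCat) (A B D : C) (e : hom A B) (f g : hom B D) :
  is_iso e -> f \oc e = g \oc e -> f = g.
Proof. by case=> e' [_ ee'] h; rewrite -[f]compm1 -[g]compm1 -ee' !compA h. Qed.

Lemma isomorphic_fob (C : addCat) (F : endofunctor C) (A B : C) :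
  isomorphic A B -> isomorphic (F A) (F B).
Proof.
case=> f [g [gf fg]]; exists (fmap F f), (fmap F g).
by rewrite /= -!fmapM gf fg !fmap1.
Qed.

Lemma isomorphic_iter (C : addCat) (F : endofunctor C) n (A B : C) :
  isomorphic A B -> isomorphic (iter n F A) (iter n F B).
Proof. by move=> h; elim: n => //= n; apply: isomorphic_fob. Qed.

Lemma hom_zero_iso (C : addCat) (A A' B B' : C) :
  isomorphic A A' -> isomorphic B B' -> hom_zero A' B' -> hom_zero A B.
Proof.
case=> f [g [gf _]] [f' [g' [g'f' _]]] h0 x.
have -> : x = g' \oc (f' \oc x \oc g) \oc f.
  by rewrite !compA g'f' comp1m -compA gf compm1.
by rewrite [X in g' \oc X]h0 compm0 comp0m.
Qed.

(** * Exactness in left triangulated categories *)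

Section LeftTriangulated.
Variable C : leftTri.
Notation Omega := (Om C).

Section Exactness.
Variables (D A B : C) (u : hom (Omega D) A) (v : hom A B) (w : hom B D).
Hypothesis t : tri u v w.

(** Consecutive maps compose to zero because (id, w) extends to a morphism from
    the triangle to Om D -> 0 -> D = D, the rotation of the trivial triangle. *)
Lemma tri_comp_wv : w \oc v = 0.
Proof.
have [Z hZ] := zero_ex C.
have [//|f [_ ->]] := tri_mor (g := w) (h := idm D) t (tri_rot (tri_id D hZ)).
by rewrite comp0m.
Qed.

(** Hom (Z, -) is exact at the middle term: when w g = 0, the square (g, 0)
    extends to a morphism from 0 -> Z = Z -> 0 to the triangle. *)
Lemma tri_exact (Z : C) (g : hom Z B) :
  w \oc g = 0 -> exists f, g = v \oc f.
Proof.
move=> wg; have [O hO] := zero_ex C.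
have [|f [_ e]] := tri_mor (g := g) (h := 0) (tri_id Z hO) t.
  by rewrite comp0m wg.
by exists f; rewrite -e compm1.
Qed.

End Exactness.

Lemma tri_comp_uw (D A B : C) (u : hom (Omega D) A) (v : hom A B)
    (w : hom B D) : tri u v w -> u \oc fmap Omega w = 0.
Proof.
move=> /tri_rot/tri_rot/tri_comp_wv; rewrite compmN => /eqP.
by rewrite oppr_eq0 => /eqP.
Qed.

(** With [tri_exact], this makes v a kernel of w. *)
Lemma tri_mono (D A B : C) (u : hom (Omega D) A) (v : hom A B) (w : hom B D) :
  tri u v w -> u = 0 -> forall (Z : C) (f g : hom Z A), v \oc f = v \oc g -> f = g.
Proof.
move=> /tri_rot t u0 Z f g e; apply/eqP; rewrite -subr_eq0; apply/eqP.
have [|h ->] := tri_exact (g := f - g) t; last by rewrite u0 comp0m.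
by rewrite compDr compmN e subrr.
Qed.

(** Only loops are available, so the complement of M is found as the fibre A of
    the retraction r: the connecting map u satisfies u Om(r) = 0 with Om(r) split
    epi, hence u = 0, so A -> P is a kernel of r and splits off. *)
Lemma retract_summand (M P : C) :
  retract M P -> exists A, is_biproduct M A P.
Proof.
case=> s [r rs]; have [A [u [v t]]] := tri_ex r.
have u0 : u = 0.
  by rewrite -[u]compm1 -fmap1 -rs fmapM compA (tri_comp_uw t) comp0m.
have [|q vq] := tri_exact (g := idm P - (s \oc r)) t.
  by rewrite compDr compmN compm1 compA rs comp1m subrr.
exists A, s, v, r, q; split=> //.
- apply: (tri_mono t u0).
  by rewrite compA -vq compDl compNm comp1m -compA (tri_comp_wv t) compm0 subr0 compm1.
- exact: tri_comp_wv t.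
- apply: (tri_mono t u0).
  by rewrite compA -vq compDl compNm comp1m -compA rs compm1 subrr compm0.
- by rewrite -vq addrC subrK.
Qed.

Lemma summand_closed_retract (X : C -> Prop) :
  summand_closed X -> retract_closed X.
Proof. by move=> sX A B /retract_summand[D /sX]; apply. Qed.

Lemma tri_zero_iso (D A B : C) (u : hom (Omega D) A) (v : hom A B)
    (w : hom B D) : tri u v w -> is_zero D -> isomorphic A B.
Proof.
move=> t hD; have u0 : u = 0.
  by rewrite -[u]compm1 -fmap1 ((hD D).1 (idm D)) fmap0 compm0.
have [|q vq] := tri_exact (g := idm B) t; first exact: (hD B).1.
exists v, q; split=> //; apply: (tri_mono t u0).
by rewrite compA -vq comp1m compm1.
Qed.

(** M is built from X by n successive triangles K -> B -> M with B in X; in a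
    triangulated category this says that M lies in the iterated extension
    X * Sigma X * ... * Sigma^n X. *)
Fixpoint resolved (X : C -> Prop) n (M : C) : Prop :=
  match n with
  | 0 => X M
  | n'.+1 => exists (K B : C) (u : hom (Omega M) K) (v : hom K B) (w : hom B M),
      [/\ tri u v w, X B & resolved X n' K]
  end.

Fixpoint coresolved (X : C -> Prop) n (M : C) : Prop :=
  match n with
  | 0 => X M
  | n'.+1 => exists (Q B : C) (u : hom (Omega Q) M) (v : hom M B) (w : hom B Q),
      [/\ tri u v w, X B & coresolved X n' Q]
  end.

Lemma resolved_iso (X : C -> Prop) n (M M' : C) : retract_closed X ->
  isomorphic M M' -> resolved X n M -> resolved X n M'.
Proof.
move=> rX iM; case: n => [|n] /=.
  by apply: rX; apply/isomorphic_retract/isomorphic_sym.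
case: iM => f [g [gf fg]] [K [B [u [v [w [t XB KX]]]]]].
exists K, B, (u \oc fmap Omega g), v, (f \oc w); split=> //.
apply: (tri_iso (is_iso1 K) (is_iso1 B) (h := f) _ _ _ _ t).
- by exists g.
- by rewrite comp1m -compA -fmapM gf fmap1 compm1.
- by rewrite comp1m compm1.
- by rewrite compm1.
Qed.

Lemma coresolved_iso (X : C -> Prop) n (M M' : C) : retract_closed X ->
  isomorphic M M' -> coresolved X n M -> coresolved X n M'.
Proof.
move=> rX iM; case: n => [|n] /=.
  by apply: rX; apply/isomorphic_retract/isomorphic_sym.
case: iM => f [g [gf fg]] [Q [B [u [v [w [t XB QX]]]]]].
exists Q, B, (f \oc u), (v \oc g), w; split=> //.
apply: (tri_iso (f := f) _ (is_iso1 B) (is_iso1 Q) _ _ _ t).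
- by exists g.
- by rewrite fmap1 compm1.
- by rewrite comp1m -compA gf compm1.
- by rewrite comp1m compm1.
Qed.

(** In the angle 0 -> X_d -> ... -> X_1 -> M -> 0 the first triangle identifies
    K_2 with M since K_1 = 0; the others resolve K_2, starting from
    K_(d+1) = X_d. *)
Lemma left_ct_resolved d (X : C -> Prop) : (0 < d)%N -> left_ct d X ->
  forall M, resolved X d.-1 M.
Proof.
move=> d0 [_ /summand_closed_retract rX res _ _] M.
have [_ [A [al [last [[K [u [v [w [e1 [e2 [t _ _ _ _]]]]]]] hA <- XA]]]]] := res M.
have iK : isomorphic (K 2%N) (A 2%N).
  by apply: tri_zero_iso (t 1%N d0) _; rewrite e1.
apply: resolved_iso rX iK _.
suff h : forall j, (j <= d.-1)%N -> resolved X j (K (d.+1 - j)%N).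
  by have := h _ (leqnn _); rewrite (_ : d.+1 - d.-1 = 2)%N //; lia.
elim=> [|j IH] hj /=; first by rewrite subn0 e2; apply: XA; lia.
have e : (d.+1 - j)%N = (d.+1 - j.+1).+1 by lia.
rewrite e in IH; set i := (d.+1 - j.+1)%N in IH *.
exists (K i.+1), (A i.+1), (u i), (v i), (w i).
split; last exact: IH (ltnW hj).
- by apply: t; lia.
- by apply: XA; lia.
Qed.

(** In the angle 0 -> M -> X^1 -> ... -> X^d -> 0 the first triangle identifies
    K_2 with X^d since K_1 = 0, and the others build K_(d+1) = M from it. *)
Lemma left_ct_coresolved d (X : C -> Prop) : (0 < d)%N -> left_ct d X ->
  forall M, coresolved X d.-1 M.
Proof.
move=> d0 [_ /summand_closed_retract rX res _ _] M.
have [[A [al [last [[K [u [v [w [e1 [e2 [t _ _ _ _]]]]]]] hA <- XA]]]] _] := res M.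
have iK : isomorphic (K 2%N) (A 2%N).
  by apply: tri_zero_iso (t 1%N d0) _; rewrite e1.
suff h : forall j, (j <= d.-1)%N -> coresolved X j (K j.+2).
  by rewrite -e2; have := h _ (leqnn _); rewrite prednK.
elim=> [|j IH] hj /=.
  by apply: rX (isomorphic_retract iK) _; apply: XA; lia.
exists (K j.+2), (A j.+3), (u j.+2), (v j.+2), (w j.+2).
split; last exact: IH (ltnW hj).
- by apply: t; lia.
- by apply: XA; lia.
Qed.

End LeftTriangulated.

(** * Cluster tilting from resolutions in triangulated categories *)

Section Triangulated.
Variable T : triCat.
Notation Omega := (Om T).
Notation Sigma := (Sg T).

Lemma Om_faithful (A B : T) (f g : hom A B) :
  fmap Omega f = fmap Omega g -> f = g.
Proof.
by move=> e; apply: (iso_epi (SgOm_iso A)); rewrite !SgOm_nat e.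
Qed.

Lemma Sg_faithful (A B : T) (f g : hom A B) :
  fmap Sigma f = fmap Sigma g -> f = g.
Proof.
by move=> e; apply: (iso_epi (OmSg_iso A)); rewrite !OmSg_nat e.
Qed.

Lemma Om_full (A B : T) (g : hom (Omega A) (Omega B)) :
  exists f, g = fmap Omega f.
Proof.
have [a' [a'a aa']] := SgOm_iso A; have [b' [b'b bb']] := SgOm_iso B.
exists (SgOm B \oc fmap Sigma g \oc a'); apply: Sg_faithful.
rewrite -[RHS]comp1m -b'b -compA -SgOm_nat -!compA a'a compm1 compA b'b.
by rewrite comp1m.
Qed.

(** Moving shifts from the target to loops on the source lets the vanishing
    conditions be combined with triangles written in terms of Om alone. *)
Lemma hom_zero_adj (A B : T) : hom_zero A (Sigma B) <-> hom_zero (Omega A) B.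
Proof.
have [b [bO Ob]] := OmSg_iso B; split=> h f; last first.
  by apply: Om_faithful; rewrite fmap0 -[LHS]comp1m -bO -compA (h (_ \oc _)) compm0.
have [g e] := Om_full (b \oc f).
by rewrite -[f]comp1m -Ob -compA e (h g) fmap0 compm0.
Qed.

Lemma hom_zero_adj_iter i (A B : T) :
  hom_zero A (iter i Sigma B) <-> hom_zero (iter i Omega A) B.
Proof.
elim: i A => //= i IH A.
by rewrite hom_zero_adj IH -iterSr.
Qed.

Section Exactness.
Variables (D A B : T) (u : hom (Omega D) A) (v : hom A B) (w : hom B D).
Hypothesis t : tri u v w.

(** Exactness of Hom (Z, -) at the last term D: in the triangle rotated twice,
    Om f is killed by u, so it factors through Om w, and Om is fully faithful. *)
Lemma tri_lift (Z : T) (f : hom Z D) :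
  hom_zero (Omega Z) A -> exists g, f = w \oc g.
Proof.
move=> h; have [|g] := tri_exact (g := fmap Omega f) (tri_rot (tri_rot t)).
  exact: h.
have [g' ->] := Om_full g; rewrite compNm -compmN -fmapN -fmapM => /Om_faithful ->.
by exists (- g').
Qed.

(** Exactness of Hom (-, Z) at A. The completion axiom only produces the first
    map of a morphism of triangles, so both the triangle and 0 -> Z = Z -> 0 are
    rotated twice; this yields the extension after applying Om. *)
Lemma tri_extend (Z : T) (f : hom A Z) :
  hom_zero (Omega D) Z -> exists g, f = g \oc v.
Proof.
move=> h; have [O hO] := zero_ex T.
have [|k [e _]] := tri_mor (g := 0) (h := f) (tri_rot (tri_rot t))
  (tri_rot (tri_rot (tri_id Z hO))).
  by rewrite compm0; apply: h.
have [k' ek] := Om_full k; exists k'; apply: Om_faithful.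
move: e; rewrite fmap1 compmN compNm comp1m => /oppr_inj <-.
by rewrite ek fmapM.
Qed.

End Exactness.

Variables (X : T -> Prop).

(** Dimension shifting: in K' -> B -> K, a map from Om Z to K lifts to B
    because Hom (Om^2 Z, K') = 0, which is the same claim for Om Z and a shorter
    resolution; and Hom (Om Z, B) = 0. *)
Lemma resolved_hom_zero n (Z K : T) : resolved X n K ->
  (forall N i, X N -> (1 <= i <= n.+1)%N -> hom_zero (iter i Omega Z) N) ->
  hom_zero (Omega Z) K.
Proof.
elim: n Z K => [|n IH] Z K /= hK h0; first exact: (h0 _ 1%N).
case: hK => K' [B [u [v [w [t XB hK']]]]] f.
have [|g ->] := tri_lift t f; last by rewrite (h0 B 1%N XB _ g) ?compm0.
by apply: IH hK' _ => N i XN hi; rewrite -iterSr; apply: h0 => //; lia.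
Qed.

Lemma coresolved_hom_zero n (Z Q : T) : coresolved X n Q ->
  (forall N i, X N -> (1 <= i <= n.+1)%N -> hom_zero N (iter i Sigma Z)) ->
  hom_zero Q (Sigma Z).
Proof.
elim: n Z Q => [|n IH] Z Q /= hQ h0; first exact: (h0 _ 1%N).
case: hQ => Q' [B [u [v [w [t XB hQ']]]]] f.
have [|g ->] := tri_extend t f; last by rewrite (h0 B 1%N XB _ g) ?comp0m.
apply: (hom_zero_adj _ _).1.
by apply: IH hQ' _ => N i XN hi; rewrite -iterSr; apply: h0 => //; lia.
Qed.

(** Taking Z in a rigid X shows that f is a right approximation; taking
    Z = M shows that M is a retract of B when M has no extensions by X. This is
    why the factorization is stated for every Z orthogonal to the shifts of X. *)
Lemma resolved_approx n (M : T) : resolved X n M ->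
  exists (B : T) (f : hom B M), X B /\ forall Z (g : hom Z M),
    (forall N i, X N -> (1 <= i <= n)%N -> hom_zero Z (iter i Sigma N)) ->
    exists h, g = f \oc h.
Proof.
case: n => [|n] /=.
  by move=> XM; exists M, (idm M); split=> // Z g _; exists g; rewrite comp1m.
case=> K [B [u [v [w [t XB hK]]]]]; exists B, w; split=> // Z g h0.
apply: (tri_lift t); apply: resolved_hom_zero hK _ => N i XN hi.
exact/hom_zero_adj_iter/h0.
Qed.

Lemma coresolved_approx n (M : T) : coresolved X n M ->
  exists (B : T) (f : hom M B), X B /\ forall Z (g : hom M Z),
    (forall N i, X N -> (1 <= i <= n)%N -> hom_zero N (iter i Sigma Z)) ->
    exists h, g = h \oc f.
Proof.
case: n => [|n] /=.
  by move=> XM; exists M, (idm M); split=> // Z g _; exists g; rewrite compm1.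
case=> Q [B [u [v [w [t XB hQ]]]]]; exists B, v; split=> // Z g h0.
apply: (tri_extend t); apply: (hom_zero_adj _ _).1.
exact: coresolved_hom_zero hQ h0.
Qed.

Lemma tri_ct_of_resolutions d : retract_closed X ->
  (forall M N i, X M -> X N -> (1 <= i <= d.-1)%N ->
    hom_zero M (iter i Sigma N)) ->
  (forall M, resolved X d.-1 M) -> (forall M, coresolved X d.-1 M) -> tri_ct d X.
Proof.
move=> rX rig hr hl; split=> M.
- split.
    have [B [f [XB hf]]] := coresolved_approx (hl M); exists B, f; split=> // N g XN.
    by apply: hf => N' i XN'; apply: rig.
  have [B [f [XB hf]]] := resolved_approx (hr M); exists B, f; split=> // N g XN.
  by apply: hf => N' i XN'; apply: rig.
- split=> [XM N i XN|h]; first exact: rig.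
  have [B [f [XB hf]]] := resolved_approx (hr M).
  have [s e] := hf _ (idm M) h.
  by apply: rX XB; exists s, f.
- split=> [XM N i XN|h]; first exact: rig.
  have [B [f [XB hf]]] := coresolved_approx (hl M).
  have [r e] := hf _ (idm M) h.
  by apply: rX XB; exists f, r.
Qed.

End Triangulated.

(** * The stabilization *)

Lemma ev_dvd d (P : int -> Prop) : (0 < d)%N -> ev P ->
  exists k, P k /\ (d %| k)%Z.
Proof.
move=> d0 [N hN]; exists (d%:Z * N%:Z); split; last exact: dvdz_mulr.
by apply: hN; nia.
Qed.

Section Stable.
Variables (d : nat) (C : leftTri) (X : C -> Prop).
Notation Omega := (Om C).

(** Looping and shifting cancel: the identity of Om^p A at stage k represents an
    isomorphism in both directions. *)
Lemma stab_iso_stage (A : C) n k p : stage ((A, n) : zob C) k p ->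
  isomorphic ((A, n) : stab C) ((iter p Omega A, - k) : stab C).
Proof.
move=> hp; have h0 : stage ((iter p Omega A, - k) : zob C) k 0.
  by rewrite /stage /=; lia.
exists (@cls C Omega (A, n) (iter p Omega A, - k) k p 0 hp h0 (idm _)),
  (@cls C Omega (iter p Omega A, - k) (A, n) k 0 p h0 hp (idm _)).
by rewrite /= (zidE _ hp) (zidE _ h0) !zcompE comp1m.
Qed.

Lemma dZsub_of (A : C) (k : int) (Y : stab C) : X A -> (d %| k)%Z ->
  isomorphic Y ((A, k) : stab C) -> dZsub d X Y.
Proof.
move=> XA /dvdzP[q e] i; exists A, q; split=> //.
by rewrite mulrC -e.
Qed.

(** At stage -n the objects (E, n) are represented by E itself, and the signs
    (-1)^n in the definition of triangles are absorbed by the maps. *)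
Lemma stab_tri (A B D : C) (u : hom (Omega D) A) (v : hom A B) (w : hom B D)
    (n : int) : tri u v w ->
  exists (u' : hom (Om (stab C) (D, n)) ((A, n) : stab C))
    (v' : hom ((A, n) : stab C) ((B, n) : stab C)) w', tri u' v' w'.
Proof.
move=> t; have h E : stage ((E, n) : zob C) (- n) 0 by rewrite /stage /=; lia.
exists (@cls C Omega (zsh 1 (D, n)) (A, n) (- n) 1 0 (stage_Om (h D)) (h A)
  (sgm (- n) u)), (cls (h A) (h B) (sgm (- n) v)), (cls (h B) (h D) (sgm (- n) w)).
exists (- n), 0%N, 0%N, 0%N, (h D), (h B), (h A), (sgm (- n) u), (sgm (- n) v),
  (sgm (- n) w).
by split=> //; rewrite !sgmK.
Qed.

Lemma resolved_stab m (M : C) (n : int) : (d %| n)%Z -> resolved X m M ->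
  @resolved (stab C) (dZsub d X) m (M, n).
Proof.
move=> dn; elim: m M => [|m IH] M /=.
  by move=> XM; apply: dZsub_of XM dn (isomorphic_refl _).
case=> K [B [u [v [w [/(stab_tri n)[u' [v' [w' t]]] XB /IH hK]]]]].
exists (K, n), (B, n), u', v', w'; split=> //.
exact: dZsub_of XB dn (isomorphic_refl _).
Qed.

Lemma coresolved_stab m (M : C) (n : int) : (d %| n)%Z -> coresolved X m M ->
  @coresolved (stab C) (dZsub d X) m (M, n).
Proof.
move=> dn; elim: m M => [|m IH] M /=.
  by move=> XM; apply: dZsub_of XM dn (isomorphic_refl _).
case=> Q [B [u [v [w [/(stab_tri n)[u' [v' [w' t]]] XB /IH hQ]]]]].
exists (Q, n), (B, n), u', v', w'; split=> //.
exact: dZsub_of XB dn (isomorphic_refl _).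
Qed.

Hypothesis d_gt0 : (0 < d)%N.
Hypothesis ctX : left_dZct d X.

Lemma iter_Om_X p A : X A -> (d %| p)%N -> X (iter p Omega A).
Proof.
move=> XA /dvdnP[q ->]; elim: q => // q IH.
by rewrite mulSn iterD; apply: ctX.2.
Qed.

Lemma stab_normal_form (Y : stab C) : exists (M : C) (n : int),
  (d %| n)%Z /\ isomorphic Y ((M, n) : stab C).
Proof.
case: Y => A n; have [k [[p hp] dk]] := ev_dvd d_gt0 (ev_stage (A, n)).
exists (iter p Omega A), (- k); split; first by rewrite rpredN.
exact: stab_iso_stage.
Qed.

(** Both maps have representatives at some stage, whose composite becomes the
    identity only after further looping, hence the large stages. *)
Lemma retract_stage (A B : C) (n m : int) :
  retract ((A, n) : stab C) ((B, m) : stab C) ->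
  ev (fun k => forall p q, stage ((A, n) : zob C) k p ->
    stage ((B, m) : zob C) k q -> retract (iter p Omega A) (iter q Omega B)).
Proof.
case=> s [r rs].
have [k [hs [hr [[p hp] [q hq]]]]] := ev_ex (ev_and (cls_ev s)
  (ev_and (cls_ev r) (ev_and (ev_stage (A, n)) (ev_stage (B, m))))).
have [a sE] := hs p q hp hq; have [b rE] := hr q p hq hp.
move: rs; rewrite sE rE /= (zidE _ hp) zcompE => /cls_ev_eq[N hN].
exists N => _ /hN[l [-> e]] p' q' /(stage_eq hp) -> /(stage_eq hq) ->.
by exists (up a l), (up b l); rewrite -upM e up1.
Qed.

Lemma dZsub_retract : retract_closed (dZsub d X : stab C -> Prop).
Proof.
case=> A n Y rAY [B [l [XB iY]]].
have /retract_stage h := retract_trans rAY (isomorphic_retract iY).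
have [k [[hk [[p hp] [q hq]]] dk]] :=
  ev_dvd d_gt0 (ev_and h (ev_and (ev_stage (A, n)) (ev_stage (B, d%:Z * l)))).
have rX : retract_closed X.
  by apply: summand_closed_retract; case: ctX => -[].
apply: dZsub_of (stab_iso_stage hp); last by rewrite rpredN.
apply: rX (hk _ _ hp hq) _; apply: iter_Om_X => //.
suff : (d%:Z %| q%:Z)%Z by [].
by rewrite hq /= rpredD ?dvdz_mulr.
Qed.

Lemma shiftz_stab (i : int) (Y : stab C) : shiftz i Y = (Y.1, Y.2 - i).
Proof.
case: Y => A n; have e (F : endofunctor (stab C)) c :
    (forall Z : zob C, F Z = (Z.1, Z.2 + c)) ->
    forall j, iter j F (A, n) = (A, n + c * j%:Z).
  move=> eF; elim=> [|j /= ->]; first by congr pair; lia.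
  by rewrite eF /=; congr pair; lia.
by case: i => j; rewrite /shiftz; [rewrite (e _ (-1))|rewrite (e _ 1)] => //;
  congr pair; rewrite /=; lia.
Qed.

Lemma isomorphic_shiftz (T : triCat) (i : int) (A B : T) :
  isomorphic A B -> isomorphic (shiftz i A) (shiftz i B).
Proof. by case: i => j; apply: isomorphic_iter. Qed.

Lemma dZsub_hom_zero (M N : stab C) (i : int) :
  dZsub d X M -> dZsub d X N -> ~~ (d %| i)%Z -> hom_zero M (shiftz i N).
Proof.
case=> A [k [XA iM]] [B [l [XB iN]]] ndi.
apply: hom_zero_iso iM (isomorphic_shiftz i iN) _.
rewrite shiftz_stab /= => f.
have [K [[hf [[p hp] [q hq]]] dK]] := ev_dvd d_gt0 (ev_and (cls_ev f)
  (ev_and (ev_stage (A, d%:Z * k)) (ev_stage (B, d%:Z * l - i)))).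
have [g ->] := hf _ _ hp hq.
have dp : (d %| p)%N.
  suff : (d%:Z %| p%:Z)%Z by [].
  by rewrite hp /= rpredD ?dvdz_mulr.
have ndq : ~~ (d %| q)%N.
  apply: contra ndi => dq; have : (d%:Z %| q%:Z)%Z by [].
  rewrite hq /= => h; rewrite (_ : i = d%:Z * l + K - (d%:Z * l - i + K)); last lia.
  by apply: rpredB h; rewrite rpredD ?dvdz_mulr.
have [r [hr dr]] : exists r, (1 <= r <= d.-1)%N /\ (d %| r + q)%N.
  (* the number of loops needed to reach the next multiple of d *)
  exists (d - q %% d)%N; have := ltn_pmod q d_gt0.
  move: ndq; rewrite /dvdn => h h'; split; first by lia.
  by rewrite {2}(divn_eq q d) addnCA subnK ?(ltnW h') // -mulSnr modnMl.
have hp' : stage ((A, d%:Z * k) : zob C) (K + r%:Z) (r + p).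
  by move: hp; rewrite /stage /=; lia.
have hq' : stage ((B, d%:Z * l - i) : zob C) (K + r%:Z) (r + q).
  by move: hq; rewrite /stage /=; lia.
rewrite (cls_up hp hq g hp' hq') (cls0 _ hp' hq'); congr cls.
case: ctX => -[_ _ _ _ rig] _.
have : hom_zero (iter r Omega (iter p Omega A)) (iter (r + q) Omega B).
  by apply: rig => //; apply: iter_Om_X.
by rewrite -iterD; apply.
Qed.

End Stable.

Theorem theorem5p7 (d : nat) (C : leftTri) (X : C -> Prop) :
  (0 < d)%N -> left_dZct d X -> tri_dZct d (dZsub d X).
Proof.
move=> d0 ctX; have rZ := dZsub_retract d0 ctX.
split; last by move=> M N i; apply: dZsub_hom_zero.
apply: tri_ct_of_resolutions => // [M N i XM XN hi|Y|Y].
- apply: (dZsub_hom_zero d0 ctX (i := i%:Z)) => //.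
  by rewrite dvdzE gtnNdvd //=; lia.
- have [M [n [dn /isomorphic_sym iY]]] := stab_normal_form d0 Y.
  exact: resolved_iso rZ iY (resolved_stab dn (left_ct_resolved d0 ctX.1 M)).
- have [M [n [dn /isomorphic_sym iY]]] := stab_normal_form d0 Y.
  exact: coresolved_iso rZ iY (coresolved_stab dn (left_ct_coresolved d0 ctX.1 M)).
Qed.
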